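(* Let $M$ be a manifold with a generalized complex structure $J$ whose $+i$-eigenbundle is $L$. Let $\Gamma_1\in C^\infty(\wedge^2L)$ and $\phi\in C^\infty(L^*\otimes L)$ form a compatible pair. Let $t$ be a real variable and define $$\Gamma(t)=\sum_{n=1}^\infty(-1)^{n-1}\frac{1}{n!}t^n\phi^{n-1}\Gamma_1,\qquad \Phi(t)=\sum_{n=0}^\infty\frac1{n!}t^n\phi^n .$$ Then $\Gamma(t)$ satisfies the Maurer-Cartan equation $\overline\partial\Gamma(t)+\frac12[\![\Gamma(t),\Gamma(t)]\!]=0$. Moreover, if $\mathrm{DGA}(\Gamma(t))$ denotes the differential Gerstenhaber algebra $(C^\infty(\wedge^\bullet L),[\![-,-]\!],\wedge,\overline\partial_{\Gamma(t)})$ with $\overline\partial_{\Gamma(t)}=\overline\partial+[\![\Gamma(t),-]\!]$, then $\Phi(t)$ is a homomorphism of differential Gerstenhaber algebras from $\mathrm{DGA}(\Gamma(t))$ to $\mathrm{DGA}(\Gamma(0))$; that is, it preserves $\wedge$ and $[\![-,-]\!]$, and $\Phi(t)\circ\overline\partial_{\Gamma(t)}=\overline\partial\circ\Phi(t)$.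
   Context: $M$ is a smooth connected manifold without boundary, $T,T^*$ its (co)tangent bundles. On $T\oplus T^*$ (and its complexification) use the pairing $\langle X+\alpha,Y+\beta\rangle=\frac12(\alpha(Y)+\beta(X))$ and the Courant bracket $[\![X+\alpha,Y+\beta]\!]=[X,Y]+\mathcal L_X\beta-\mathcal L_Y\alpha-\frac12d(\iota_X\beta-\iota_Y\alpha)$. A generalized complex structure is a real bundle map $J$ of $T\oplus T^*$ with $J^2=-1$, $J^*=-J$, whose $+i$-eigenbundle $L\subset(T\oplus T^* )_{\mathbb C}$ has space of sections closed under the Courant bracket. $L$ is maximal isotropic, $(T\oplus T^* )_{\mathbb C}=L\oplus\overline L$, and $\overline L\cong L^*$ (and $L\cong\overline L^*$) via $2\langle-,-\rangle$. With $\rho$ the projection to $T_{\mathbb C}$, both $L,\overline L$ are Lie algebroids. The bracket on $C^\infty(L)$ extends to the Schouten bracket $[\![-,-]\!]$ on $C^\infty(\wedge^\bullet L)$: $[\![\ell,f]\!]=\rho(\ell)f$ for functions $f$, $[\![A,B\wedge C]\!]=[\![A,B]\!]\wedge C+(-1)^{(a-1)b}B\wedge[\![A,C]\!]$, $[\![A,B]\!]=-(-1)^{(a-1)(b-1)}[\![B,A]\!]$, where $a,b$ are the degrees of $A,B$. The operator $\overline\partial:C^\infty(\wedge^nL)\to C^\infty(\wedge^{n+1}L)$ is the Lie algebroid differential of $\overline L$ (with $L\cong\overline L^*$): $(\overline\partial\ell)(\overline\ell_1,\overline\ell_2)=\rho(\overline\ell_1)(\ell(\overline\ell_2))-\rho(\overline\ell_2)(\ell(\overline\ell_1))-\ell([\![\overline\ell_1,\overline\ell_2]\!])$,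 extended as a degree-one graded derivation of $\wedge$. Then $(C^\infty(\wedge^\bullet L),[\![-,-]\!],\wedge,\overline\partial)$ is the differential Gerstenhaber algebra (DGA) of $J$. Compatible pair: $\Gamma_1\in C^\infty(\wedge^2L)$ and $\phi\in C^\infty(L^*\otimes L)=C^\infty(\mathrm{End}(L))$, extended to $\wedge^\bullet L$ as a derivation of $\wedge$ (zero on functions), form a compatible pair if $\overline\partial\Gamma_1=0$ and for all $A,B\in C^\infty(\wedge^\bullet L)$: (i) $\overline\partial(\phi A)-\phi(\overline\partial A)=[\![\Gamma_1,A]\!]$; (ii) $[\![\phi A,B]\!]+[\![A,\phi B]\!]=\phi[\![A,B]\!]$; (iii) $\phi(A\wedge B)=(\phi A)\wedge B+A\wedge(\phi B)$. $\phi^n$ is the $n$-fold composition of $\phi$ on $\wedge^\bullet L$, with $\phi^0=\mathrm{id}$. *)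

(* Defs.v *)
From HB Require Import structures.
From mathcomp Require Import all_boot all_order all_algebra ssrAC.
From mathcomp Require Import all_classical all_reals all_analysis.
From mathcomp Require Import ring.

Set Implicit Arguments.
Unset Strict Implicit.
Unset Printing Implicit Defensive.

Import Order.TTheory GRing.Theory Num.Theory.
Import numFieldNormedType.Exports.

Local Open Scope classical_set_scope.
Local Open Scope ring_scope.

Section Euclidean.
Variables (R : realType) (n : nat).
Implicit Types (U : set 'rV[R]_n) (f g : 'rV[R]_n -> R).

(* Only meaningful for open U: then the partial derivatives at a point of U
   only involve the values of f on U. *)
Fixpoint Ck_on (k : nat) U f : Prop :=
  (forall x, U x -> {for x, continuous f}) /\
  if k is k'.+1 then forall i : 'I_n,
      (forall x, U x -> derivable f x (delta_mx 0 i)) /\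
      Ck_on k' U (fun x => 'D_(delta_mx 0 i) f x)
  else True.

Definition smooth_on U f : Prop := forall k, Ck_on k U f.

Lemma Ck_onS k U f : Ck_on k.+1 U f -> Ck_on k U f.
Proof.
elim: k f => [|k IH] f /= [cf Hf]; split=> // i.
by have [df H] := Hf i; split=> //; apply: IH.
Qed.

Lemma Ck_on_eq k U f g : open U -> (forall x, U x -> f x = g x) ->
  Ck_on k U f -> Ck_on k U g.
Proof.
move=> oU; elim: k f g => [|k IH] f g fg.
all: have nfg x : U x -> \near x, f x = g x
       by move=> Ux; apply: filterS (open_nbhs_nbhs (conj oU Ux)).
all: have cg : (forall x, U x -> {for x, continuous f}) ->
               forall x, U x -> {for x, continuous g}
       by move=> cf x Ux; rewrite /prop_for /continuous_at -fg //;
          apply: cvg_trans (cf x Ux) => P /= HP;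
          apply: filterS2 (nfg x Ux) HP => z /= ->.
  by move=> [cf _]; split=> //; exact: cg.
move=> [cf H]; split; first exact: cg.
move=> i; have [df Hk] := H i; split.
  by move=> x Ux; apply: near_eq_derivable (df x Ux); apply: nfg.
by apply: IH Hk => x Ux; apply: near_eq_derive; apply: nfg.
Qed.

Lemma Ck_on_cst k U (a : R) : open U -> Ck_on k U (cst a).
Proof.
move=> oU; elim: k a => [|k IH] a /=; first by split=> // x _; exact: cst_continuous.
split; first by move=> x _; exact: cst_continuous.
move=> i; split; first by move=> x _; exact: derivable_cst.
by apply: Ck_on_eq (IH 0) => // x _; rewrite derive_cst.
Qed.

Lemma Ck_onD k U f g : open U -> Ck_on k U f -> Ck_on k U g ->
  Ck_on k U (f + g).
Proof.
move=> oU; elim: k f g => [|k IH] f g [cf Hf] [cg Hg].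
  by split=> // x Ux; apply: continuousD; [exact: cf|exact: cg].
split; first by move=> x Ux; apply: continuousD; [exact: cf|exact: cg].
move=> i; have [df Hdf] := Hf i; have [dg Hdg] := Hg i; split.
  by move=> x Ux; apply: derivableD; [exact: df|exact: dg].
apply: Ck_on_eq (IH _ _ Hdf Hdg) => // x Ux.
by rewrite deriveD //; [exact: df|exact: dg].
Qed.

Lemma Ck_onM k U f g : open U -> Ck_on k U f -> Ck_on k U g ->
  Ck_on k U (f * g).
Proof.
move=> oU; elim: k f g => [|k IH] f g Cf Cg.
  have [cf _] := Cf; have [cg _] := Cg.
  by split=> // x Ux; apply: continuousM; [exact: cf|exact: cg].
have [cf Hf] := Cf; have [cg Hg] := Cg.
split; first by move=> x Ux; apply: continuousM; [exact: cf|exact: cg].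
move=> i; have [df Hdf] := Hf i; have [dg Hdg] := Hg i; split.
  by move=> x Ux; apply: derivableM; [exact: df|exact: dg].
apply: Ck_on_eq
  (Ck_onD oU (IH _ _ (Ck_onS Cf) Hdg) (IH _ _ (Ck_onS Cg) Hdf)) => // x Ux.
by rewrite deriveM //; [exact: df|exact: dg].
Qed.

End Euclidean.

(* cmap is only meaningful on cdom, and cinv on the image of cdom. *)
Record chart (R : realType) (n : nat) (T : topologicalType) := Chart {
  cdom : set T;
  cmap : T -> 'rV[R]_n;
  cinv : 'rV[R]_n -> T;
  cdom_open : open cdom;
  cimg_open : open (cmap @` cdom);
  cmapK : forall x, cdom x -> cinv (cmap x) = x;
  cmap_continuous : forall x, cdom x -> {for x, continuous cmap};
  cinv_continuous : forall y, (cmap @` cdom) y -> {for y, continuous cinv} }.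

Record manifold (R : realType) (n : nat) := Manifold {
  msort :> topologicalType;
  matlas : set (chart R n msort);
  m_nonempty : [set: msort] !=set0;
  m_hausdorff : hausdorff_space msort;
  m_second_countable : @second_countable msort;
  m_connected : connected [set: msort];
  matlas_cover : forall x : msort, exists2 c, matlas c & cdom c x;
  matlas_compatible : forall c d, matlas c -> matlas d -> forall i : 'I_n,
    smooth_on (cmap c @` (cdom c `&` cdom d))
              (fun y => cmap d (cinv c y) 0 i) }.

Section Cinf.
Variables (R : realType) (n : nat) (M : manifold R n).

Definition smooth (f : M -> R) : Prop :=
  forall c, matlas c -> smooth_on (cmap c @` cdom c) (f \o cinv c).

Record Cinf := MkCinf { cfun :> M -> R; cfun_smooth : smooth cfun }.

Lemma cinf_eq (f g : Cinf) : (forall x, f x = g x) -> f = g.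
Proof.
case: f g => [f Hf] [g Hg] /= /funext fg; rewrite fg in Hf *.
by congr MkCinf; exact: Prop_irrelevance.
Qed.

HB.instance Definition _ := gen_eqMixin Cinf.
HB.instance Definition _ := gen_choiceMixin Cinf.

Lemma smooth_cst (a : R) : smooth (cst a).
Proof. by move=> c Mc k; apply: (@Ck_on_cst R n k _ a); exact: cimg_open. Qed.

Lemma smoothD (f g : M -> R) : smooth f -> smooth g -> smooth (f + g).
Proof.
by move=> sf sg c Mc k; apply: Ck_onD;
  [exact: cimg_open|exact: sf|exact: sg].
Qed.

Lemma smoothM (f g : M -> R) : smooth f -> smooth g -> smooth (f * g).
Proof.
by move=> sf sg c Mc k; apply: Ck_onM;
  [exact: cimg_open|exact: sf|exact: sg].
Qed.

Lemma smoothN (f : M -> R) : smooth f -> smooth (- f).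
Proof. by rewrite -mulN1r => sf; apply: smoothM => //; exact: (smooth_cst (-1)). Qed.

Definition ccst a := MkCinf (smooth_cst a).
Definition cadd (f g : Cinf) := MkCinf (smoothD (cfun_smooth f) (cfun_smooth g)).
Definition cmul (f g : Cinf) := MkCinf (smoothM (cfun_smooth f) (cfun_smooth g)).
Definition copp (f : Cinf) := MkCinf (smoothN (cfun_smooth f)).

Fact caddA : associative cadd.
Proof. by move=> f g h; apply: cinf_eq => x; exact: addrA. Qed.
Fact caddC : commutative cadd.
Proof. by move=> f g; apply: cinf_eq => x; exact: addrC. Qed.
Fact cadd0 : left_id (ccst 0) cadd.
Proof. by move=> f; apply: cinf_eq => x; exact: add0r. Qed.
Fact caddN : left_inverse (ccst 0) copp cadd.
Proof. by move=> f; apply: cinf_eq => x; exact: addNr. Qed.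
HB.instance Definition _ := GRing.isZmodule.Build Cinf caddA caddC cadd0 caddN.

Fact cmulA : associative cmul.
Proof. by move=> f g h; apply: cinf_eq => x; exact: mulrA. Qed.
Fact cmulC : commutative cmul.
Proof. by move=> f g; apply: cinf_eq => x; exact: mulrC. Qed.
Fact cmul1 : left_id (ccst 1) cmul.
Proof. by move=> f; apply: cinf_eq => x; exact: mul1r. Qed.
Fact cmulDl : left_distributive cmul cadd.
Proof. by move=> f g h; apply: cinf_eq => x; exact: mulrDl. Qed.
HB.instance Definition _ :=
  GRing.Zmodule_isComPzRing.Build Cinf cmulA cmulC cmul1 cmulDl.

Lemma cinf_addE (f g : Cinf) x : (f + g) x = f x + g x. Proof. by []. Qed.
Lemma cinf_oppE (f : Cinf) x : (- f) x = - f x. Proof. by []. Qed.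
Lemma cinf_mulE (f g : Cinf) x : (f * g) x = f x * g x. Proof. by []. Qed.
Lemma cinf_0E x : (0 : Cinf) x = 0. Proof. by []. Qed.
Lemma cinf_1E x : (1 : Cinf) x = 1. Proof. by []. Qed.

End Cinf.

Section Fields.
Variables (R : realType) (n : nat) (M : manifold R n).
Local Notation A := (Cinf M).

(* sections of T, as the R-linear derivations of C^oo(M) *)
Record vfield := MkVfield {
  vf :> A -> A;
  vfD : forall f g, vf (f + g) = vf f + vf g;
  vfZ : forall (a : R) f, vf (ccst M a * f) = ccst M a * vf f;
  vfM : forall f g, vf (f * g) = vf f * g + f * vf g }.

Lemma vfield_eq (X Y : vfield) : (forall f, X f = Y f) -> X = Y.
Proof.
case: X Y => [X X1 X2 X3] [Y Y1 Y2 Y3] /= /funext XY.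
by subst Y; congr MkVfield; exact: Prop_irrelevance.
Qed.

HB.instance Definition _ := gen_eqMixin vfield.
HB.instance Definition _ := gen_choiceMixin vfield.

Fact vf0D (f g : A) : 0 = 0 + 0 :> A. Proof. by rewrite addr0. Qed.
Fact vf0Z (a : R) (f : A) : 0 = ccst M a * 0. Proof. by rewrite mulr0. Qed.
Fact vf0M (f g : A) : 0 = 0 * g + f * 0. Proof. by rewrite mul0r mulr0 addr0. Qed.
Definition vf0 := @MkVfield (fun=> 0) vf0D vf0Z vf0M.

Fact vfadd_D (X Y : vfield) : let h f := X f + Y f in
  forall f g, h (f + g) = h f + h g.
Proof. by move=> h f g; rewrite /h !vfD addrACA. Qed.
Fact vfadd_Z (X Y : vfield) : let h f := X f + Y f in
  forall (a : R) f, h (ccst M a * f) = ccst M a * h f.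
Proof. by move=> h a f; rewrite /h !vfZ mulrDr. Qed.
Fact vfadd_M (X Y : vfield) : let h f := X f + Y f in
  forall f g, h (f * g) = h f * g + f * h g.
Proof. by move=> h f g; rewrite /h !vfM mulrDl mulrDr addrACA. Qed.
Definition vfadd (X Y : vfield) := MkVfield (@vfadd_D X Y ) (@vfadd_Z X Y ) (@vfadd_M X Y ).

Fact vfopp_D (X : vfield) : let h f := - X f in
  forall f g, h (f + g) = h f + h g.
Proof. by move=> h f g; rewrite /h vfD opprD. Qed.
Fact vfopp_Z (X : vfield) : let h f := - X f in
  forall (a : R) f, h (ccst M a * f) = ccst M a * h f.
Proof. by move=> h a f; rewrite /h vfZ mulrN. Qed.
Fact vfopp_M (X : vfield) : let h f := - X f in
  forall f g, h (f * g) = h f * g + f * h g.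
Proof. by move=> h f g; rewrite /h vfM opprD mulNr mulrN. Qed.
Definition vfopp (X : vfield) := MkVfield (@vfopp_D X ) (@vfopp_Z X ) (@vfopp_M X ).

Fact vfscale_D (k : A) (X : vfield) : let h f := k * X f in
  forall f g, h (f + g) = h f + h g.
Proof. by move=> h f g; rewrite /h vfD mulrDr. Qed.
Fact vfscale_Z (k : A) (X : vfield) : let h f := k * X f in
  forall (a : R) f, h (ccst M a * f) = ccst M a * h f.
Proof. by move=> h a f; rewrite /h vfZ mulrCA. Qed.
Fact vfscale_M (k : A) (X : vfield) : let h f := k * X f in
  forall f g, h (f * g) = h f * g + f * h g.
Proof. by move=> h f g; rewrite /h vfM mulrDr mulrA [k * (f * _)]mulrCA. Qed.
Definition vfscale (k : A) (X : vfield) := MkVfield (@vfscale_D k  X ) (@vfscale_Z k  X ) (@vfscale_M k  X ).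

Fact vfaddA : associative vfadd.
Proof. by move=> X Y Z; apply: vfield_eq => f; exact: addrA. Qed.
Fact vfaddC : commutative vfadd.
Proof. by move=> X Y; apply: vfield_eq => f; exact: addrC. Qed.
Fact vfadd0 : left_id vf0 vfadd.
Proof. by move=> X; apply: vfield_eq => f; exact: add0r. Qed.
Fact vfaddN : left_inverse vf0 vfopp vfadd.
Proof. by move=> X; apply: vfield_eq => f; exact: addNr. Qed.
HB.instance Definition _ :=
  GRing.isZmodule.Build vfield vfaddA vfaddC vfadd0 vfaddN.

Fact vfscaleA (a b : A) (X : vfield) :
  vfscale a (vfscale b X) = vfscale (a * b) X.
Proof. by apply: vfield_eq => f; exact: mulrA. Qed.
Fact vfscale1 : left_id 1 vfscale.
Proof. by move=> X; apply: vfield_eq => f; exact: mul1r. Qed.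
Fact vfscaleDr : right_distributive vfscale +%R.
Proof. by move=> a X Y; apply: vfield_eq => f; exact: mulrDr. Qed.
Fact vfscaleDl (X : vfield) : {morph vfscale^~ X : a b / a + b}.
Proof. by move=> a b; apply: vfield_eq => f; exact: mulrDl. Qed.
HB.instance Definition _ :=
  GRing.Zmodule_isLmodule.Build A vfield vfscaleA vfscale1 vfscaleDr vfscaleDl.

(* sections of T^*, as the C^oo(M)-linear maps from vector fields to functions *)
Record oneform := MkOneform {
  omf :> vfield -> A;
  omfP : forall f X Y, omf (f *: X + Y) = f * omf X + omf Y }.

Lemma oneform_eq (a b : oneform) : (forall X, a X = b X) -> a = b.
Proof.
case: a b => [a Ha] [b Hb] /= /funext ab; subst b.
by congr MkOneform; exact: Prop_irrelevance.
Qed.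

Lemma omfD (a : oneform) X Y : a (X + Y) = a X + a Y.
Proof. by rewrite -[X in a (X + _)]scale1r omfP mul1r. Qed.
Lemma omf0 (a : oneform) : a 0 = 0.
Proof. by apply: (addrI (a 0)); rewrite -omfD !addr0. Qed.
Lemma omfZ (a : oneform) f X : a (f *: X) = f * a X.
Proof. by rewrite -[f *: X]addr0 omfP omf0 addr0. Qed.
Lemma omfN (a : oneform) X : a (- X) = - a X.
Proof. by rewrite -scaleN1r omfZ mulN1r. Qed.

HB.instance Definition _ := gen_eqMixin oneform.
HB.instance Definition _ := gen_choiceMixin oneform.

Fact om0P (f : A) (X Y : vfield) : 0 = f * 0 + 0 :> A.
Proof. by rewrite mulr0 addr0. Qed.
Definition om0 := @MkOneform (fun=> 0) om0P.

Fact omaddP (a b : oneform) : let h X := a X + b X in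
  forall f X Y, h (f *: X + Y) = f * h X + h Y.
Proof. by move=> h f X Y; rewrite /h !omfP mulrDr addrACA. Qed.
Definition omadd a b := MkOneform (@omaddP a b).

Fact omoppP (a : oneform) : let h X := - a X in
  forall f X Y, h (f *: X + Y) = f * h X + h Y.
Proof. by move=> h f X Y; rewrite /h omfP opprD mulrN. Qed.
Definition omopp a := MkOneform (@omoppP a).

Fact omscaleP (k : A) (a : oneform) : let h X := k * a X in
  forall f X Y, h (f *: X + Y) = f * h X + h Y.
Proof. by move=> h f X Y; rewrite /h omfP mulrDr mulrCA. Qed.
Definition omscale k a := MkOneform (@omscaleP k a).

Fact omaddA : associative omadd.
Proof. by move=> X Y Z; apply: oneform_eq => f; exact: addrA. Qed.
Fact omaddC : commutative omadd.
Proof. by move=> X Y; apply: oneform_eq => f; exact: addrC. Qed.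
Fact omadd0 : left_id om0 omadd.
Proof. by move=> X; apply: oneform_eq => f; exact: add0r. Qed.
Fact omaddN : left_inverse om0 omopp omadd.
Proof. by move=> X; apply: oneform_eq => f; exact: addNr. Qed.
HB.instance Definition _ :=
  GRing.isZmodule.Build oneform omaddA omaddC omadd0 omaddN.

Fact omscaleA (a b : A) (X : oneform) :
  omscale a (omscale b X) = omscale (a * b) X.
Proof. by apply: oneform_eq => f; exact: mulrA. Qed.
Fact omscale1 : left_id 1 omscale.
Proof. by move=> X; apply: oneform_eq => f; exact: mul1r. Qed.
Fact omscaleDr : right_distributive omscale +%R.
Proof. by move=> a X Y; apply: oneform_eq => f; exact: mulrDr. Qed.
Fact omscaleDl (X : oneform) : {morph omscale^~ X : a b / a + b}.
Proof. by move=> a b; apply: oneform_eq => f; exact: mulrDl. Qed.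
HB.instance Definition _ :=
  GRing.Zmodule_isLmodule.Build A oneform omscaleA omscale1 omscaleDr omscaleDl.

Lemma vfN (X : vfield) f : X (- f) = - X f.
Proof.
suff -> : - f = ccst M (-1) * f.
  by rewrite vfZ; apply: cinf_eq => x; rewrite cinf_mulE mulN1r.
by apply: cinf_eq => x; rewrite cinf_mulE mulN1r.
Qed.

Fact lie_D (X Y : vfield) : let h f := X (Y f) - Y (X f) in
  forall f g, h (f + g) = h f + h g.
Proof. by move=> h f g; rewrite /h !vfD opprD addrACA. Qed.
Fact lie_Z (X Y : vfield) : let h f := X (Y f) - Y (X f) in
  forall (a : R) f, h (ccst M a * f) = ccst M a * h f.
Proof. by move=> h a f; rewrite /h !vfZ mulrBr. Qed.
Fact lie_M (X Y : vfield) : let h f := X (Y f) - Y (X f) in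
  forall f g, h (f * g) = h f * g + f * h g.
Proof. by move=> h f g; rewrite /h !(vfM, vfD); ring. Qed.
Definition lie (X Y : vfield) := MkVfield (@lie_D X Y ) (@lie_Z X Y ) (@lie_M X Y ).

Fact extdP (f : A) (k : A) (X Y : vfield) : (k *: X + Y) f = k * X f + Y f.
Proof. by []. Qed.
Definition extd (f : A) : oneform := MkOneform (extdP f).

Lemma vfield_scaleE (k : A) (X : vfield) f : (k *: X) f = k * X f.
Proof. by []. Qed.
Lemma vfield_addE (X Y : vfield) f : (X + Y) f = X f + Y f.
Proof. by []. Qed.
Lemma vfield_oppE (X : vfield) f : (- X) f = - X f.
Proof. by []. Qed.
Lemma oneform_addE (a b : oneform) X : (a + b) X = a X + b X.
Proof. by []. Qed.
Lemma oneform_oppE (a : oneform) X : (- a) X = - a X.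
Proof. by []. Qed.
Lemma oneform_scaleE f (a : oneform) X : (f *: a) X = f * a X.
Proof. by []. Qed.
Lemma lieE (X Y : vfield) f : lie X Y f = X (Y f) - Y (X f).
Proof. by []. Qed.

Lemma lie_linr (X Y Z : vfield) k :
  lie X (k *: Y + Z) = k *: lie X Y + X k *: Y + lie X Z.
Proof.
apply: vfield_eq => g.
by rewrite !(lieE, vfield_addE, vfield_scaleE, vfM, vfD); ring.
Qed.

Fact liedP (X : vfield) (b : oneform) : let h Y := X (b Y) - b (lie X Y) in
  forall f Y Z, h (f *: Y + Z) = f * h Y + h Z.
Proof.
move=> h f Y Z; rewrite /h lie_linr !(omfD, omfZ) vfD vfM; ring.
Qed.
Definition lied (X : vfield) (b : oneform) : oneform := MkOneform (@liedP X b).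

(* sections of T (+) T^* *)
Definition gtan : Type := (vfield * oneform)%type.
HB.instance Definition _ := GRing.Lmodule.on gtan.

Definition pairing (u v : gtan) : A :=
  ccst M 2^-1 * (u.2 v.1 + v.2 u.1).

Definition courant (u v : gtan) : gtan :=
  (lie u.1 v.1,
   lied u.1 v.2 - lied v.1 u.2 - ccst M 2^-1 *: extd (v.2 u.1 - u.2 v.1)).

Lemma courant2E u v Z : (courant u v).2 Z =
  (u.1 (v.2 Z) - v.2 (lie u.1 Z)) - (v.1 (u.2 Z) - u.2 (lie v.1 Z))
  - ccst M 2^-1 * Z (v.2 u.1 - u.2 v.1).
Proof. by []. Qed.

Lemma courantNl u v : courant (- u) v = - courant u v.
Proof.
case: u v => [X a] [Y b]; congr pair.
  by apply: vfield_eq => f; rewrite !(lieE, vfield_oppE, vfN) /=; ring.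
apply: oneform_eq => Z; rewrite !courant2E !(vfield_oppE, oneform_oppE) /=.
have -> : lie (- X) Z = - lie X Z.
  by apply: vfield_eq => f; rewrite !(lieE, vfield_oppE, vfN); ring.
by rewrite !(omfN, vfN, vfD) /=; ring.
Qed.

Lemma courantNr u v : courant u (- v) = - courant u v.
Proof.
case: u v => [X a] [Y b]; congr pair.
  by apply: vfield_eq => f; rewrite !(lieE, vfield_oppE, vfN) /=; ring.
apply: oneform_eq => Z; rewrite !courant2E !(vfield_oppE, oneform_oppE) /=.
have -> : lie (- Y) Z = - lie Y Z.
  by apply: vfield_eq => f; rewrite !(lieE, vfield_oppE, vfN); ring.
by rewrite !(omfN, vfN, vfD) /=; ring.
Qed.

Lemma pairingDr u v w : pairing u (v + w) = pairing u v + pairing u w.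
Proof.
rewrite /pairing -[(v + w).1]/(v.1 + w.1) -[(v + w).2]/(v.2 + w.2).
by rewrite omfD oneform_addE; ring.
Qed.
Lemma pairingZr u f v : pairing u (f *: v) = f * pairing u v.
Proof.
rewrite /pairing -[(f *: v).1]/(f *: v.1) -[(f *: v).2]/(f *: v.2).
by rewrite omfZ oneform_scaleE; ring.
Qed.
Lemma pairingNr u v : pairing u (- v) = - pairing u v.
Proof. by rewrite -scaleN1r pairingZr mulN1r. Qed.

End Fields.

(* cplx V is V (x) C, with Cplx u v standing for u + i v.  It is used for
   functions, for sections of T (+) T^*, and (cplx R) for C itself. *)
Record cplx (V : Type) := Cplx { cre : V; cim : V }.

Lemma cplx_eq (V : Type) (u v : cplx V) : cre u = cre v -> cim u = cim v -> u = v.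
Proof. by case: u v => [a b] [c d] /= -> ->. Qed.

HB.instance Definition _ (V : Type) := gen_eqMixin (cplx V).
HB.instance Definition _ (V : Type) := gen_choiceMixin (cplx V).

(* the C-bilinear extension of an R-bilinear map *)
Definition cbil (U V W : zmodType) (b : U -> V -> W) (u : cplx U) (v : cplx V) :
    cplx W :=
  Cplx (b (cre u) (cre v) - b (cim u) (cim v))
       (b (cre u) (cim v) + b (cim u) (cre v)).

Section CplxZmod.
Variable V : zmodType.
Definition cplx_add (u v : cplx V) := Cplx (cre u + cre v) (cim u + cim v).
Definition cplx_opp (u : cplx V) := Cplx (- cre u) (- cim u).
Definition cplx_conj (u : cplx V) := Cplx (cre u) (- cim u).
Fact cplx_addA : associative cplx_add.
Proof. by move=> u v w; apply: cplx_eq; exact: addrA. Qed.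
Fact cplx_addC : commutative cplx_add.
Proof. by move=> u v; apply: cplx_eq; exact: addrC. Qed.
Fact cplx_add0 : left_id (Cplx 0 0) cplx_add.
Proof. by move=> u; apply: cplx_eq; exact: add0r. Qed.
Fact cplx_addN : left_inverse (Cplx 0 0) cplx_opp cplx_add.
Proof. by move=> u; apply: cplx_eq; exact: addNr. Qed.
HB.instance Definition _ :=
  GRing.isZmodule.Build (cplx V) cplx_addA cplx_addC cplx_add0 cplx_addN.

Lemma cplx_conjK : involutive cplx_conj.
Proof. by move=> u; apply: cplx_eq => //=; rewrite opprK. Qed.
Lemma cplx_conjD : {morph cplx_conj : u v / u + v}.
Proof. by move=> u v; apply: cplx_eq => //=; rewrite opprD. Qed.
End CplxZmod.

Section CplxRing.
Variable A : comPzRingType.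
Definition cplx_mul : cplx A -> cplx A -> cplx A := cbil *%R.
Fact cplx_mulA : associative cplx_mul.
Proof. by move=> u v w; apply: cplx_eq => /=; ring. Qed.
Fact cplx_mulC : commutative cplx_mul.
Proof. by move=> u v; apply: cplx_eq => /=; ring. Qed.
Fact cplx_mul1 : left_id (Cplx 1 0) cplx_mul.
Proof. by move=> u; apply: cplx_eq => /=; ring. Qed.
Fact cplx_mulDl : left_distributive cplx_mul +%R.
Proof. by move=> u v w; apply: cplx_eq => /=; ring. Qed.
HB.instance Definition _ := GRing.Zmodule_isComPzRing.Build (cplx A)
  cplx_mulA cplx_mulC cplx_mul1 cplx_mulDl.
End CplxRing.

Section CplxLmod.
Variables (A : comPzRingType) (V : lmodType A).
Definition cplx_scale : cplx A -> cplx V -> cplx V := cbil *:%R.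
Fact cplx_scaleA a b u : cplx_scale a (cplx_scale b u) = cplx_scale (a * b) u.
Proof.
apply: cplx_eq => /=;
  rewrite !(scalerDr, scalerBr, scalerDl, scalerBl, scalerN, scaleNr, scalerA) ?opprD.
  by rewrite (AC (2*2) ((1*4)*(2*3))%AC).
by rewrite (AC (2*2) ((1*4)*(2*3))%AC).
Qed.
Fact cplx_scale1 : left_id 1 cplx_scale.
Proof.
by move=> u; apply: cplx_eq; rewrite /= !scale1r scale0r ?subr0 ?addr0.
Qed.
Fact cplx_scaleDr : right_distributive cplx_scale +%R.
Proof.
move=> a u v; apply: cplx_eq; rewrite /= !scalerDr ?opprD addrACA //.
Qed.
Fact cplx_scaleDl u : {morph cplx_scale^~ u : a b / a + b}.
Proof.
move=> a b; apply: cplx_eq; rewrite /= !scalerDl ?opprD addrACA //.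
Qed.
HB.instance Definition _ := GRing.Zmodule_isLmodule.Build (cplx A) (cplx V)
  cplx_scaleA cplx_scale1 cplx_scaleDr cplx_scaleDl.
End CplxLmod.

Definition ci (A : pzRingType) : cplx A := Cplx 0 1.
Arguments ci {A}.

Section AltForms.
Variables (K : comPzRingType) (T : lmodType K).

Definition wlin (P : seq T -> K) := forall s1 s2 (f : K) u v,
  P (s1 ++ (f *: u + v) :: s2) = f * P (s1 ++ u :: s2) + P (s1 ++ v :: s2).
Definition walt (P : seq T -> K) := forall s1 s2 s3 u,
  P (s1 ++ u :: s2 ++ u :: s3) = 0.

(* An inhomogeneous form: its value on a sequence of length k is that of its
   component of degree k, an alternating K-multilinear form. *)
Record altform := MkAltform {
  wfun :> seq T -> K;
  wfun_lin : wlin wfun;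
  wfun_alt : walt wfun }.

Lemma altform_eq (P Q : altform) : (forall s, P s = Q s) -> P = Q.
Proof.
case: P Q => [P P1 P2] [Q Q1 Q2] /= /funext PQ; subst Q.
by congr MkAltform; exact: Prop_irrelevance.
Qed.

HB.instance Definition _ := gen_eqMixin altform.
HB.instance Definition _ := gen_choiceMixin altform.

Fact w0_lin : wlin (fun=> 0).
Proof. by move=> *; rewrite mulr0 addr0. Qed.
Fact w0_alt : walt (fun=> 0). Proof. by []. Qed.
Definition w0 := MkAltform w0_lin w0_alt.

Fact wadd_lin (P Q : altform) : wlin (fun s => P s + Q s).
Proof. by move=> s1 s2 f u v; rewrite !wfun_lin; ring. Qed.
Fact wadd_alt (P Q : altform) : walt (fun s => P s + Q s).
Proof. by move=> *; rewrite !wfun_alt addr0. Qed.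
Definition wadd P Q := MkAltform (@wadd_lin P Q) (@wadd_alt P Q).

Fact wopp_lin (P : altform) : wlin (fun s => - P s).
Proof. by move=> s1 s2 f u v; rewrite !wfun_lin; ring. Qed.
Fact wopp_alt (P : altform) : walt (fun s => - P s).
Proof. by move=> *; rewrite !wfun_alt oppr0. Qed.
Definition wopp P := MkAltform (@wopp_lin P) (@wopp_alt P).

Fact wscale_lin (a : K) (P : altform) : wlin (fun s => a * P s).
Proof. by move=> s1 s2 f u v; rewrite !wfun_lin; ring. Qed.
Fact wscale_alt (a : K) (P : altform) : walt (fun s => a * P s).
Proof. by move=> *; rewrite !wfun_alt mulr0. Qed.
Definition wscale a P := MkAltform (@wscale_lin a P) (@wscale_alt a P).

Fact waddA : associative wadd.
Proof. by move=> P Q S; apply: altform_eq => s; exact: addrA. Qed.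
Fact waddC : commutative wadd.
Proof. by move=> P Q; apply: altform_eq => s; exact: addrC. Qed.
Fact wadd0 : left_id w0 wadd.
Proof. by move=> P; apply: altform_eq => s; exact: add0r. Qed.
Fact waddN : left_inverse w0 wopp wadd.
Proof. by move=> P; apply: altform_eq => s; exact: addNr. Qed.
HB.instance Definition _ := GRing.isZmodule.Build altform waddA waddC wadd0 waddN.

Fact wscaleA a b P : wscale a (wscale b P) = wscale (a * b) P.
Proof. by apply: altform_eq => s; exact: mulrA. Qed.
Fact wscale1 : left_id 1 wscale.
Proof. by move=> P; apply: altform_eq => s; exact: mul1r. Qed.
Fact wscaleDr : right_distributive wscale +%R.
Proof. by move=> a P Q; apply: altform_eq => s; exact: mulrDr. Qed.
Fact wscaleDl P : {morph wscale^~ P : a b / a + b}.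
Proof. by move=> a b; apply: altform_eq => s; exact: mulrDl. Qed.
HB.instance Definition _ := GRing.Zmodule_isLmodule.Build K altform
  wscaleA wscale1 wscaleDr wscaleDl.

Definition homog (k : nat) (P : altform) : Prop :=
  forall s, size s != k -> P s = 0.

Definition wcst_fun (f : K) (s : seq T) : K :=
  if s is [::] then f else 0.
Fact wcst_lin f : wlin (wcst_fun f).
Proof. by case=> [|? ?] *; rewrite /= mulr0 addr0. Qed.
Fact wcst_alt f : walt (wcst_fun f).
Proof. by case. Qed.
Definition wcst f : altform := MkAltform (wcst_lin f) (wcst_alt f).

(* The wedge product, by recursion on the arguments, from the contraction rule
     i_u (P ^ Q) = (i_u P) ^ Q + (-1)^deg(P) P ^ (i_u Q);
   on degree one, (P ^ Q)(u, v) = P(u) Q(v) - P(v) Q(u). *)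
Definition wcontr (u : T) (P : seq T -> K) :=
  fun s => P (u :: s).
Definition winvol (P : seq T -> K) :=
  fun s => (-1) ^+ size s * P s.
Fixpoint wedge_fun (P Q : seq T -> K) (s : seq T) : K :=
  if s is u :: s' then
    wedge_fun (wcontr u P) Q s' + wedge_fun (winvol P) (wcontr u Q) s'
  else P [::] * Q [::].

Lemma wedge_fun_linl f P P' Q s :
  wedge_fun (fun s => f * P s + P' s) Q s = f * wedge_fun P Q s + wedge_fun P' Q s.
Proof.
elim: s P P' Q => [|u s IH] P P' Q /=; first by ring.
rewrite (IH (wcontr u P)).
have -> : winvol (fun s => f * P s + P' s) = (fun s => f * winvol P s + winvol P' s).
  by apply/funext => z; rewrite /winvol; ring.
by rewrite IH; ring.
Qed.

Lemma wedge_fun_linr f P Q Q' s :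
  wedge_fun P (fun s => f * Q s + Q' s) s = f * wedge_fun P Q s + wedge_fun P Q' s.
Proof.
elim: s P Q Q' => [|u s IH] P Q Q' /=; first by ring.
by rewrite IH (IH _ (wcontr u Q)); ring.
Qed.

Lemma wlin_contr u P : wlin P -> wlin (wcontr u P).
Proof. by move=> HP s1 s2 f v w; exact: (HP (u :: s1)). Qed.
Lemma walt_contr u P : walt P -> walt (wcontr u P).
Proof. by move=> HP s1 s2 s3 v; exact: (HP (u :: s1)). Qed.
Lemma wlin_invol P : wlin P -> wlin (winvol P).
Proof.
by move=> HP s1 s2 f v w; rewrite /winvol !HP !size_cat /=; ring.
Qed.
Lemma walt_invol P : walt P -> walt (winvol P).
Proof. by move=> HP s1 s2 s3 v; rewrite /winvol HP mulr0. Qed.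

Lemma wedge_fun_lin P Q : wlin P -> wlin Q -> wlin (wedge_fun P Q).
Proof.
move=> HP HQ s1; elim: s1 P Q HP HQ => [|w s1 IH] P Q HP HQ s2 f u v /=; last first.
  rewrite (IH _ _ (wlin_contr w HP) HQ) (IH _ _ (wlin_invol HP) (wlin_contr w HQ)).
  by ring.
have -> : wcontr (f *: u + v) P = (fun s => f * wcontr u P s + wcontr v P s).
  by apply/funext => z; exact: (HP [::]).
have -> : wcontr (f *: u + v) Q = (fun s => f * wcontr u Q s + wcontr v Q s).
  by apply/funext => z; exact: (HQ [::]).
by rewrite wedge_fun_linl wedge_fun_linr; ring.
Qed.

Lemma wedge_fun0l Q s : wedge_fun (fun=> 0) Q s = 0.
Proof.
elim: s Q => [|u s IH] Q /=; first by rewrite mul0r.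
have -> : winvol (fun=> 0) = (fun=> 0) by apply/funext => z; rewrite /winvol mulr0.
by rewrite !IH addr0.
Qed.

Lemma wedge_fun0r P s : wedge_fun P (fun=> 0) s = 0.
Proof.
by elim: s P => [|u s IH] P /=; [rewrite mulr0|rewrite !IH addr0].
Qed.

Lemma wedge_fun_adj P Q s1 s2 u : walt P -> walt Q ->
  wedge_fun P Q (s1 ++ u :: u :: s2) = 0.
Proof.
elim: s1 P Q => [|w s1 IH] P Q HP HQ /=; last first.
  rewrite IH // ?IH ?addr0 //; [exact: walt_invol|exact: walt_contr..].
have -> : wcontr u (wcontr u P) = (fun=> 0).
  by apply/funext => z; exact: (HP [::] [::]).
have -> : wcontr u (wcontr u Q) = (fun=> 0).
  by apply/funext => z; exact: (HQ [::] [::]).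
have -> : wcontr u (winvol P) = (fun z => (-1) * winvol (wcontr u P) z + 0).
  by apply/funext => z; rewrite /wcontr /winvol /= exprS; ring.
by rewrite wedge_fun0l wedge_fun0r wedge_fun_linl wedge_fun0l; ring.
Qed.

Lemma walt_of_adj P : wlin P ->
  (forall s1 s2 u, P (s1 ++ u :: u :: s2) = 0) -> walt P.
Proof.
move=> lP aP.
have lD s1 s2 u v : P (s1 ++ (u + v) :: s2) = P (s1 ++ u :: s2) + P (s1 ++ v :: s2).
  by rewrite -[u in LHS]scale1r lP mul1r.
have swap s1 s2 u v : P (s1 ++ u :: v :: s2) = - P (s1 ++ v :: u :: s2).
  apply/eqP; rewrite -addr_eq0; have := aP s1 s2 (u + v).
  have lD2 w : P (s1 ++ w :: (u + v) :: s2) =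
               P (s1 ++ w :: u :: s2) + P (s1 ++ w :: v :: s2).
    by rewrite -!(cat_rcons w) lD.
  by rewrite lD !lD2 !aP add0r addr0 => ->.
move=> s1 s2 s3 u; elim: s2 s1 => [|v s2 IH] s1 /=; first exact: aP.
by rewrite swap -cat_rcons IH oppr0.
Qed.

Fact wedge_lin (P Q : altform) : wlin (wedge_fun P Q).
Proof. by apply: wedge_fun_lin; exact: wfun_lin. Qed.
Fact wedge_alt (P Q : altform) : walt (wedge_fun P Q).
Proof.
apply: walt_of_adj; first exact: wedge_lin.
by move=> *; apply: wedge_fun_adj; exact: wfun_alt.
Qed.
Definition wedge (P Q : altform) : altform := MkAltform (@wedge_lin P Q) (@wedge_alt P Q).

End AltForms.

Section GCS.
Variables (R : realType) (n : nat) (M : manifold R n).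

Definition cJ (J : gtan M -> gtan M) (e : cplx (gtan M)) : cplx (gtan M) :=
  Cplx (J (cre e)) (J (cim e)).

Record gcs := Gcs {
  gJ :> {linear gtan M -> gtan M};
  gJ_sqr : forall u, gJ (gJ u) = - u;
  gJ_skew : forall u v, pairing (gJ u) v = - pairing u (gJ v);
  gJ_closed : forall e1 e2 : cplx (gtan M),
    cJ gJ e1 = ci *: e1 -> cJ gJ e2 = ci *: e2 ->
    cJ gJ (cbil (@courant _ _ M) e1 e2) = ci *: cbil (@courant _ _ M) e1 e2 }.

End GCS.

Section Eigenbundle.
Variables (R : realType) (n : nat) (M : manifold R n) (J : gcs M).
Local Notation A := (Cinf M).
Local Notation E := (gtan M).

Definition inL : {pred cplx E} := fun e => `[< cJ J e = ci *: e >].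
Definition inLbar : {pred cplx E} := fun e => `[< cplx_conj e \in inL >].

Lemma inLP e : reflect (cJ J e = ci *: e) (e \in inL).
Proof. exact: asboolP. Qed.

Fact inL_submod : submod_closed inL.
Proof.
split; first by apply/inLP; apply: cplx_eq; rewrite scaler0 /= linear0.
move=> a u v /inLP Hu /inLP Hv; apply/inLP.
have -> : cJ J (a *: u + v) = a *: cJ J u + cJ J v.
  by apply: cplx_eq => /=; [rewrite linearD linearB|rewrite !linearD];
     rewrite -?(linearZZ J).
by rewrite Hu Hv scalerDr !scalerA mulrC.
Qed.
HB.instance Definition _ := GRing.isSubmodClosed.Build (cplx A) (cplx E) inL
  inL_submod.

Lemma cplx_conjZ (a : cplx A) (u : cplx E) :
  cplx_conj (a *: u) = cplx_conj a *: cplx_conj u.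
Proof.
by apply: cplx_eq; rewrite /= !(scalerN, scaleNr) ?opprK ?opprD.
Qed.

Lemma inLbarP e : reflect (cplx_conj e \in inL) (e \in inLbar).
Proof. exact: asboolP. Qed.

Fact inLbar_submod : submod_closed inLbar.
Proof.
split=> [|a u v].
  apply/inLbarP.
  have -> : cplx_conj 0 = 0 :> cplx E by apply: cplx_eq; rewrite //= oppr0.
  exact: rpred0.
move=> /inLbarP Hu /inLbarP Hv; apply/inLbarP.
by rewrite cplx_conjD cplx_conjZ; apply: rpredD => //; apply: rpredZ.
Qed.
HB.instance Definition _ := GRing.isSubmodClosed.Build (cplx A) (cplx E) inLbar
  inLbar_submod.

(* the C^oo(M;C)-modules of global sections of L and of its conjugate *)
Definition Lsec : Type := {e | e \in inL}.
Definition Lbarsec : Type := {e | e \in inLbar}.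
HB.instance Definition _ := SubChoice.on Lsec.
HB.instance Definition _ := SubChoice.on Lbarsec.
HB.instance Definition _ := [SubChoice_isSubLmodule of Lsec by <:].
HB.instance Definition _ := [SubChoice_isSubLmodule of Lbarsec by <:].


Lemma cbil_conj (U V W : zmodType) (b : U -> V -> W) :
  (forall u v, b (- u) v = - b u v) -> (forall u v, b u (- v) = - b u v) ->
  forall u v, cbil b (cplx_conj u) (cplx_conj v) = cplx_conj (cbil b u v).
Proof.
by move=> bl br u v; apply: cplx_eq; rewrite /= !(bl, br) ?opprK ?opprD.
Qed.

Fact Lbr_subproof (u v : Lsec) : cbil (@courant R n M) (val u) (val v) \in inL.
Proof. by apply/inLP; apply: gJ_closed; apply/inLP; [exact: (svalP u)|exact: (svalP v)]. Qed.

Fact Lbarbr_subproof (u v : Lbarsec) :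
  cbil (@courant R n M) (val u) (val v) \in inLbar.
Proof.
apply/inLbarP; rewrite -cbil_conj; [|exact: courantNl|exact: courantNr].
by apply/inLP; apply: gJ_closed; apply/inLP; apply/inLbarP;
  [exact: (svalP u)|exact: (svalP v)].
Qed.

Definition Lbr (u v : Lsec) : Lsec := exist (fun e => e \in inL) _ (Lbr_subproof u v).
Definition Lbarbr (u v : Lbarsec) : Lbarsec := exist (fun e => e \in inLbar) _ (Lbarbr_subproof u v).

Definition anchor (e : cplx E) (f : cplx A) : cplx A :=
  cbil (fun (u : E) (g : A) => u.1 g) e f.

(* Sections of the exterior algebra of L, where L is identified with Lbar^* by
   2<-,->: functions f are embedded by wcst f, sections of L by wvec l. *)
Definition wedgeL : Type := altform Lbarsec.
HB.instance Definition _ := GRing.Lmodule.on wedgeL.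

Lemma cpairing_lin (e : cplx E) f u v :
  cbil (@pairing R n M) e (f *: u + v) =
  f * cbil (@pairing R n M) e u + cbil (@pairing R n M) e v.
Proof.
apply: cplx_eq; rewrite /= !(pairingDr, pairingNr, pairingZr).
all: move: (pairing (cre e) (cre u)) (pairing (cre e) (cim u))
  (pairing (cim e) (cre u)) (pairing (cim e) (cim u))
  (pairing (cre e) (cre v)) (pairing (cre e) (cim v))
  (pairing (cim e) (cre v)) (pairing (cim e) (cim v)) => *.
all: by ring.
Qed.

Definition wvec_fun (l : Lsec) (s : seq Lbarsec) : cplx A :=
  if s is [:: u] then 2%:R * cbil (@pairing R n M) (val l) (val u) else 0.
Fact wvec_lin l : wlin (wvec_fun l).
Proof.
case=> [|? [|? ?]] [|? ?] f u v; rewrite /= ?(mulr0, addr0) //.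
by rewrite cpairing_lin mulrDr mulrCA.
Qed.
Fact wvec_alt l : walt (wvec_fun l).
Proof. by case=> [|? [|? ?]] []. Qed.
Definition wvec (l : Lsec) : wedgeL := MkAltform (wvec_lin l) (wvec_alt l).

End Eigenbundle.

Section DGA.
Variables (R : realType) (n : nat) (M : manifold R n) (J : gcs M).
Local Notation W := (wedgeL J).
Local Notation "P ^^ Q" := (wedge P Q : W) (at level 40, left associativity).
Implicit Types (P Q S : W) (f : cplx (Cinf M)).

Definition Cconst (c : cplx R) : cplx (Cinf M) :=
  Cplx (ccst M (cre c)) (ccst M (cim c)).
Definition Rconst (r : R) : cplx (Cinf M) := Cconst (Cplx r 0).

Definition Clinear (F : W -> W) : Prop :=
  forall c P Q, F (Cconst c *: P + Q) = Cconst c *: F P + F Q.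

(* The Schouten bracket is the unique operation with these properties: it is
   determined by its values on functions and on sections of L, which locally
   generate wedge^. L.  Signs only involve degrees mod 2, so a.+1 stands for
   a - 1 in them. *)
Record is_schouten (br : W -> W -> W) : Prop := {
  sch_linl : forall Q, Clinear (br^~ Q);
  sch_linr : forall P, Clinear (br P);
  (* degree a + b - 1; in particular zero when a = b = 0 *)
  sch_homog : forall a b P Q, homog a P -> homog b Q ->
    forall s, (size s).+1 != (a + b)%N -> br P Q s = 0;
  sch_vec : forall l1 l2 : Lsec J, br (wvec l1) (wvec l2) = wvec (Lbr l1 l2);
  sch_anchor : forall (l : Lsec J) f,
    br (wvec l) (wcst _ f) = wcst _ (anchor (val l) f);
  sch_leibniz : forall a b P Q S, homog a P -> homog b Q ->
    br P (Q ^^ S) = br P Q ^^ S + (-1) ^+ (a.+1 * b) *: (Q ^^ br P S);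
  sch_skew : forall a b P Q, homog a P -> homog b Q ->
    br P Q = - ((-1) ^+ (a.+1 * b.+1) *: br Q P) }.

(* The Lie algebroid differential of Lbar, likewise determined by its values
   in degrees 0 and 1. *)
Record is_dbar (dbar : W -> W) : Prop := {
  dbar_lin : Clinear dbar;
  dbar_homog : forall k P, homog k P -> homog k.+1 (dbar P);
  dbar_fun : forall f u, dbar (wcst _ f) [:: u] = anchor (val u) f;
  dbar_deg1 : forall P, homog 1 P -> forall u v, dbar P [:: u; v] =
    anchor (val u) (P [:: v]) - anchor (val v) (P [:: u]) - P [:: Lbarbr u v];
  dbar_wedge : forall a P Q, homog a P ->
    dbar (P ^^ Q) = dbar P ^^ Q + (-1) ^+ a *: (P ^^ dbar Q) }.

(* phi is the extension of phi0, an endomorphism of L, to wedge^. L as a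
   derivation of degree zero vanishing on functions. *)
Record is_extension (phi0 : Lsec J -> Lsec J) (phi : W -> W) : Prop := {
  ext_lin : Clinear phi;
  ext_homog : forall k P, homog k P -> homog k (phi P);
  ext_fun : forall f, phi (wcst _ f) = 0;
  ext_vec : forall l, phi (wvec l) = wvec (phi0 l);
  ext_wedge : forall P Q, phi (P ^^ Q) = phi P ^^ Q + P ^^ phi Q }.

Record compatible_pair (br : W -> W -> W) (dbar : W -> W)
    (G1 : W) (phi0 : {linear Lsec J -> Lsec J}) (phi : W -> W) : Prop := {
  cp_homog : homog 2 G1;
  cp_ext : is_extension phi0 phi;
  cp_closed : dbar G1 = 0;
  cp_dbar : forall P, dbar (phi P) - phi (dbar P) = br G1 P;
  cp_br : forall P Q, br (phi P) Q + br P (phi Q) = phi (br P Q);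
  cp_wedge : forall P Q, phi (P ^^ Q) = phi P ^^ Q + P ^^ phi Q }.

Definition dbar_def (br : W -> W -> W) (dbar : W -> W) (G P : W) : W :=
  dbar P + br G P.

Record is_dga_hom (br : W -> W -> W) (d1 d2 F : W -> W) : Prop := {
  hom_lin : Clinear F;
  hom_homog : forall k P, homog k P -> homog k (F P);
  hom_wedge : forall P Q, F (P ^^ Q) = F P ^^ F Q;
  hom_br : forall P Q, F (br P Q) = br (F P) (F Q);
  hom_d : forall P, F (d1 P) = d2 (F P) }.

(* Convergence in every fibre of wedge^. L: evaluate on sections of Lbar, then
   at a point of M. *)
Definition wcvg (P_ : nat -> W) (P : W) : Prop := forall s (x : M),
  (cre (P_ N s) x @[N --> \oo] --> cre (P s) x) /\
  (cim (P_ N s) x @[N --> \oo] --> cim (P s) x).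

End DGA.

(* Main.v *)
(* Write rho for the anchor.  Condition (ii) on a section l and a function f gives
   rho (phi l) f = 0, so phi maps L into its intersection with T^*.  Condition (i)
   on f gives phi (dbar f) = - [G1, f].  An element a of L contained in T^* is locally
   a combination sum_j a_j dbar y_j, and writing G1 = sum b /\ c shows that phi a only
   involves the values a (rho b) and a (rho c), which vanish since L is isotropic.
   Hence phi^2 = 0 on L, and phi^(k+1) = 0 on wedge^k L because phi is a derivation;
   as L has finite rank, phi is nilpotent and both series are finite sums.  The
   theorem is then formal: exp (t phi) is a morphism for every bilinear operation of
   which phi is a derivation, and exp (- t phi) dbar exp (t phi) = dbar + [G(t), -].

   With vector fields defined as derivations of C^oo(M), the local frames used in this
   argument come from Hadamard's lemma and smooth bump functions in a chart. *)

(* Only global sections are available, so a frame near p is replaced by an identity chi *: u = sum_g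
   c_g(u) *: e_g between global sections, with chi nonzero at p. A claim is proved after
   multiplication by chi and then read off at p; this works because phi and the bracket with a
   function commute with multiplication by functions. The families e_g may be linearly dependent:
   only their size matters for the degree bound, and it is the same at every p, so one nilpotency
   order serves all of M.

   The formal half is calculus in t. Since G' = G1 - phi G, the expression E = 2 dbar G + [G, G]
   satisfies E' = - phi E and vanishes at t = 0; likewise exp (- t phi) dbar exp (t phi) has
   derivative [G', -]. Each such differential equation becomes a recursion between the terms of
   order k and k + 1, multiplied by k + 1 to absorb the factorials, and induction on k replaces
   uniqueness of solutions. *)
Require Import Defs.
From HB Require Import structures.
From mathcomp Require Import all_boot all_order all_algebra.
From mathcomp Require Import all_classical all_reals all_analysis.
From mathcomp Require Import ring lra.

Set Implicit Arguments.
Unset Strict Implicit.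
Unset Printing Implicit Defensive.

Import Order.TTheory GRing.Theory Num.Theory.
Import numFieldNormedType.Exports.

Local Open Scope classical_set_scope.
Local Open Scope ring_scope.

(** * Partial derivatives and the chain rule *)

Section Calculus.
Variable R : realType.

Lemma is_derive_line (V W : normedModType R) (F : V -> W) (a v : V) (s : R) :
  derivable F (a + s *: v) v ->
  is_derive s 1 (fun t : R => F (a + t *: v)) ('D_v F (a + s *: v)).
Proof.
have E : (fun h : R => h^-1 *: (((fun t : R => F (a + t *: v)) \o shift s) (h *: 1) -
    F (a + s *: v)))
   = (fun h => h^-1 *: ((F \o shift (a + s *: v)) (h *: v) - F (a + s *: v))).
  apply/funext => h /=; rewrite [h *: 1]mulr1; congr (_ *: (F _ - _)).
  by rewrite scalerDl addrCA.
by move=> dF; split; rewrite /derivable /derive E.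
Qed.

Lemma MVT_line (V : normedModType R) (F : V -> R^o) (a v : V) (s : R) :
  (forall t : R, `|t| <= `|s| -> derivable F (a + t *: v) v) ->
  exists2 t : R, `|t| <= `|s| & F (a + s *: v) - F a = 'D_v F (a + t *: v) * s.
Proof.
move=> dF; pose g (t : R) := F (a + t *: v).
have dg (t : R) : `|t| <= `|s| -> is_derive t 1 g ('D_v F (a + t *: v)).
  by move=> /dF; exact: is_derive_line.
have g0 : g 0 = F a by rewrite /g scale0r addr0.
have [s0|s0|->] := ltgtP s 0; last first.
- by exists 0; rewrite ?normr0 // scale0r addr0 subrr mulr0.
- have bd (t : R) : t \in `[0, s] -> `|t| <= `|s|.
    by rewrite in_itv /= => /andP[t0 st]; rewrite !ger0_norm // ltW.
  have [||t ts E] := @MVT _ g (fun t => 'D_v F (a + t *: v)) 0 s s0.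
  + by move=> t ts; apply/dg/bd; exact: subset_itv_oo_cc ts.
  + by apply: derivable_within_continuous => t /bd/dg[].
  exists t; first by apply/bd/subset_itv_oo_cc.
  by rewrite -g0 -/(g s) E subr0.
- have bd (t : R) : t \in `[s, 0] -> `|t| <= `|s|.
    by rewrite in_itv /= => /andP[st t0]; rewrite !ler0_norm ?lerN2 // ltW.
  have [||t ts E] := @MVT _ g (fun t => 'D_v F (a + t *: v)) s 0 s0.
  + by move=> t ts; apply/dg/bd; exact: subset_itv_oo_cc ts.
  + by apply: derivable_within_continuous => t /bd/dg[].
  exists t; first by apply/bd/subset_itv_oo_cc.
  by rewrite -g0 -opprB -/(g s) E sub0r mulrN opprK.
Qed.

Lemma cvg_rV_ballP m (f : 'rV[R]_m -> R) (y : 'rV[R]_m) (l : R) :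
  f z @[z --> y] --> l <->
  forall e, 0 < e -> exists2 d, 0 < d & forall z, ball y d z -> `|l - f z| < e.
Proof.
pose FF : Filter (nbhs y) := nbhs_filter y; split.
  move=> /(@cvgrPdist_lt _ _ _ _ FF) H e /H /nbhs_ballP[d d0 dP].
  by exists d.
move=> H; apply/(@cvgrPdist_lt _ _ _ _ FF) => e /H[d d0 dP].
by apply/nbhs_ballP; exists d.
Qed.

(** Pass from y to z one coordinate at a time: [hyb z k] has the first k coordinates of z and the
    others of y. Each [q j] is the difference quotient of one such step, hence by the mean value
    theorem a partial derivative at a point of the same sup-norm ball, and continuity of the
    partials gives the limit. This yields the chain rule from partial derivatives alone. *)
Lemma C1_caratheodory m (U : set 'rV[R]_m) (F : 'rV[R]_m -> R) (y : 'rV[R]_m) :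
  open U -> Ck_on 1 U F -> U y ->
  exists q : 'I_m -> 'rV[R]_m -> R,
    (forall z, F z - F y = \sum_j q j z * (z 0 j - y 0 j)) /\
    (forall j, q j z @[z --> y] --> 'D_(delta_mx 0 j) F y).
Proof.
move=> oU [_ dF] Uy.
pose hyb (z : 'rV[R]_m) (k : nat) := \row_i (if (i < k)%N then z 0 i else y 0 i).
have hybS z (j : 'I_m) : hyb z j.+1 = hyb z j + (z 0 j - y 0 j) *: delta_mx 0 j.
  apply/rowP => i; rewrite !mxE eqxx /= ltnS leq_eqVlt -val_eqE.
  case: (ltngtP i j) => [||/val_inj ->] /=; rewrite ?mulr0 ?addr0 //.
  by rewrite mulr1 addrC subrK.
pose q (j : 'I_m) (z : 'rV[R]_m) := if z 0 j == y 0 j then 'D_(delta_mx 0 j) F y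
  else (F (hyb z j.+1) - F (hyb z j)) / (z 0 j - y 0 j).
exists q; split=> [z|j].
  have -> : F z - F y = \sum_(0 <= j < m) (F (hyb z j.+1) - F (hyb z j)).
    rewrite telescope_sumr //; congr (F _ - F _); apply/rowP => i; rewrite mxE.
      by rewrite ltn_ord.
    by rewrite ltn0.
  rewrite big_mkord; apply: eq_bigr => j _; rewrite /q.
  have [E|ne] := eqVneq (z 0 j) (y 0 j); last by rewrite mulfVK ?subr_eq0.
  by rewrite hybS E subrr scale0r addr0 subrr mulr0.
have [dFj [cD _]] := dF j.
apply/cvg_rV_ballP => e e0.
have /nbhs_ballP[r /= r0 brU] : nbhs y U by exact: open_nbhs_nbhs.
have /cvg_rV_ballP/(_ e e0)[d d0 bd] := cD _ Uy.
have rd0 : 0 < Num.min r d by rewrite lt_min r0.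
exists (Num.min r d) => //= z [_ zy].
rewrite /q; case: ifPn => [_|ne]; first by rewrite subrr normr0.
have inb (t : R) : `|t| <= `|z 0 j - y 0 j| ->
    ball y (Num.min r d) (hyb z j + t *: delta_mx 0 j).
  move=> ht; split=> // a i; rewrite (ord1 a) /ball /= !mxE eqxx /=.
  have [->|ij] := eqVneq i j; last first.
    rewrite mulr0 addr0; case: ifP => _; first by have := zy 0 i.
    by rewrite subrr normr0.
  rewrite ltnn mulr1 opprD addrA subrr sub0r normrN; apply: le_lt_trans ht _.
  by have := zy 0 j; rewrite /ball /= distrC.
have [|t ht E] := @MVT_line _ F (hyb z j) (delta_mx 0 j) (z 0 j - y 0 j).
  move=> t ht; apply: dFj; apply: brU.
  by apply: le_ball (inb t ht); rewrite ge_min lexx.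
rewrite hybS E mulfK ?subr_eq0 //; apply: bd.
by apply: le_ball (inb t ht); rewrite ge_min lexx orbT.
Qed.

Lemma cvg_rowP (T : Type) (F : set_system T) (FF : Filter F) m (g : T -> 'rV[R]_m)
    (l : 'rV[R]_m) :
  (forall j, (fun t => g t 0 j) @ F --> l 0 j) -> g @ F --> l.
Proof.
move=> gl; apply/cvgrPdist_lt => e e0;
near=> t.
have : forall j, `|l 0 j - g t 0 j| < e.
  by near: t; apply: filter_forall => j; move/cvgrPdist_lt: (gl j); apply.
move=> H.
have : ball l e (g t) by split=> // a j; rewrite (ord1 a); exact: H.
by rewrite -ball_normE.
Unshelve. all: by end_near. Qed.

(** The factorisation of F at g x turns the difference quotient of the composite into a finite sum
    of products, each factor of which converges. *)
Lemma C1_chain m (V : normedModType R) (U : set 'rV[R]_m) (F : 'rV[R]_m -> R)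
    (g : V -> 'rV[R]_m) (dg : 'I_m -> R) (x v : V) :
  open U -> Ck_on 1 U F -> U (g x) ->
  (forall j, is_derive x v (fun z => g z 0 j) (dg j)) ->
  is_derive x v (F \o g) (\sum_j 'D_(delta_mx 0 j) F (g x) * dg j).
Proof.
move=> oU CF Ugx Hg; have [q [Eq cq]] := C1_caratheodory oU CF Ugx.
pose gl (h : R) := g (h *: v + x).
have cgl : gl h @[h --> 0^'] --> g x.
  apply: cvg_rowP => j; have [/derivable1P/derivable1_diffP dj _] := Hg j.
  have /differentiable_continuous := dj.
  rewrite /prop_for /continuous_at /= scale0r add0r => H; exact: cvg_within_filter H.
have key : h^-1 *: ((F \o g \o shift x) (h *: v) - (F \o g) x) @[h --> 0^'] -->
    \sum_j 'D_(delta_mx 0 j) F (g x) * dg j.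
  have -> : (fun h : R => h^-1 *: ((F \o g \o shift x) (h *: v) - (F \o g) x)) =
    (fun h : R => \sum_j q j (gl h) * (h^-1 *: (g (h *: v + x) 0 j - g x 0 j))).
    apply/funext => h /=; rewrite Eq scaler_sumr; apply: eq_bigr => j _.
    by rewrite -scalerAr.
  apply: cvg_big => [|j _]; first exact: add_continuous.
  apply: cvgM; first exact: cvg_comp cgl (cq j).
  by have [dj <-] := Hg j; exact: dj.
split; first by apply/cvg_ex; eexists; exact: key.
exact: cvg_lim key.
Qed.

End Calculus.

(** * Smooth functions on open sets, bump functions *)

Section SmoothOn.
Variable R : realType.

Lemma Ck_on1 n k (U : set 'rV[R]_n) (f : 'rV[R]_n -> R) : Ck_on k.+1 U f -> Ck_on 1 U f.
Proof. by elim: k => // k IH /Ck_onS/IH. Qed.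

Lemma Ck_on_sum n k (U : set 'rV[R]_n) m (f : 'I_m -> 'rV[R]_n -> R) :
  open U -> (forall j, Ck_on k U (f j)) -> Ck_on k U (fun x => \sum_j f j x).
Proof.
move=> oU Hf.
have -> : (fun x => \sum_j f j x) = \sum_j f j by apply/funext => x; rewrite fct_sumE.
by apply: big_ind => //; [exact: Ck_on_cst|move=> f1 f2; exact: Ck_onD].
Qed.

Lemma Ck_on_comp m n k (U : set 'rV[R]_n) (V : set 'rV[R]_m) F g :
  open U -> open V -> (forall x, U x -> V (g x)) -> Ck_on k V F ->
  (forall j, Ck_on k U (fun x => g x 0 j)) -> Ck_on k U (F \o g).
Proof.
move=> oU oV UV; elim: k F => [|k IH] F CF Cg.
all: have cFg x : U x -> {for x, continuous (F \o g)}
  by move=> Ux; apply: continuous_comp;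
     [apply: (@cvg_rowP _ _ _ (nbhs_filter x)) => j; have [cg _] := Cg j; exact: cg
     |have [cF _] := CF; exact/cF/UV].
  by split.
have dFg i x : U x -> is_derive x (delta_mx 0 i) (F \o g)
   (\sum_j 'D_(delta_mx 0 j) F (g x) * 'D_(delta_mx 0 i) (fun z => g z 0 j) x).
  move=> Ux; apply: (C1_chain oV (Ck_on1 CF)); first exact: UV.
  by move=> j; have [_ /(_ i)[dg _]] := Cg j; apply/derivableP/dg.
split=> // i; split; first by move=> x Ux; have [] := dFg i x Ux.
apply: (@Ck_on_eq _ _ _ _ (fun x => \sum_j 'D_(delta_mx 0 j) F (g x) *
   'D_(delta_mx 0 i) (fun z => g z 0 j) x)) => // [x Ux|].
  by have [_ ->] := dFg i x Ux.
apply: Ck_on_sum => // j; apply: Ck_onM => //.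
  apply: (IH ('D_(delta_mx 0 j) F)); first by have [_ /(_ j)[]] := CF.
  by move=> l; exact/Ck_onS/Cg.
by have [_ /(_ i)[]] := Cg j.
Qed.

Lemma is_derive_coord n (x v : 'rV[R]_n) (i : 'I_n) :
  is_derive x v (fun z : 'rV[R]_n => z 0 i) (v 0 i).
Proof.
have H : h^-1 *: (((fun z : 'rV[R]_n => z 0 i) \o shift x) (h *: v) - x 0 i) @[h --> 0^']
   --> v 0 i.
  apply: cvg_near_cst; near=> h.
  rewrite /= !mxE addrK -[_ *: _]/(_ * _) mulKf //.
  by near: h; exact: nbhs_dnbhs_neq.
by split; [apply/cvg_ex; eexists; exact: H|exact: cvg_lim H].
Unshelve. all: by end_near. Qed.

Lemma Ck_on_coord n k (U : set 'rV[R]_n) (i : 'I_n) :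
  open U -> Ck_on k U (fun z => z 0 i).
Proof.
move=> oU; have cc (x : 'rV[R]_n) : {for x, continuous (fun z : 'rV[R]_n => z 0 i)}.
  exact: coord_continuous.
case: k => [|k]; first by split=> // x _; exact: cc.
split=> [x _|j]; first exact: cc.
split=> [x _|]; first by have [] := is_derive_coord x (delta_mx 0 j) i.
apply: (Ck_on_eq oU _ (Ck_on_cst k ((delta_mx 0 j : 'rV[R]_n) 0 i) oU)) => x _ /=.
by have [_ ->] := is_derive_coord x (delta_mx 0 j) i.
Qed.

Variable n : nat.
Implicit Types (U V : set 'rV[R]_n) (f g : 'rV[R]_n -> R).

Lemma smooth_on_sub U V f : V `<=` U -> smooth_on U f -> smooth_on V f.
Proof.
move=> VU sf k; elim: k f sf => [|k IH] f sf.
  by have [cf _] := sf 0%N; split=> // x /VU; exact: cf.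
have [cf Hf] := sf k.+1; split; first by move=> x /VU; exact: cf.
move=> i; split; first by move=> x /VU; apply: (Hf i).1.
by apply: IH => l; have [_ /(_ i)[]] := sf l.+1.
Qed.

Lemma smooth_on_local U f :
  (forall x, U x -> exists V, [/\ open V, V x & smooth_on V f]) -> smooth_on U f.
Proof.
move=> H k; elim: k f H => [|k IH] f H /=.
  by split=> // x /H[V [_ Vx /(_ 0%N)[cf _]]]; exact: cf.
split; first by move=> x /H[V [_ Vx /(_ 0%N)[cf _]]]; exact: cf.
move=> i; split; first by move=> x /H[V [_ Vx /(_ 1%N)[_ /(_ i)[df _]]]]; exact: df.
apply: IH => x /H[V [oV Vx sf]]; exists V; split=> // l.
by have [_ /(_ i)[]] := sf l.+1.
Qed.

Lemma smooth_on_eq U f g : open U -> (forall x, U x -> f x = g x) ->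
  smooth_on U f -> smooth_on U g.
Proof. by move=> oU fg sf k; apply: Ck_on_eq fg (sf k). Qed.

Lemma smooth_on_derive U f (i : 'I_n) :
  smooth_on U f -> smooth_on U ('D_(delta_mx 0 i) f).
Proof. by move=> sf k; have [_ /(_ i)[]] := sf k.+1. Qed.

Lemma smooth_on_derivable U f (i : 'I_n) x :
  smooth_on U f -> U x -> derivable f x (delta_mx 0 i).
Proof. by move=> sf Ux; have [_ /(_ i)[df _]] := sf 1%N; exact: df. Qed.

Lemma smooth_on_continuous U f x : smooth_on U f -> U x -> {for x, continuous f}.
Proof. by move=> sf Ux; have [cf _] := sf 0%N; exact: cf. Qed.

Lemma smooth_onM U f g : open U -> smooth_on U f -> smooth_on U g ->
  smooth_on U (f * g).
Proof. by move=> oU sf sg k; apply: Ck_onM. Qed.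

Lemma smooth_on_prod U m (f : 'I_m -> 'rV[R]_n -> R) :
  open U -> (forall j, smooth_on U (f j)) -> smooth_on U (fun x => \prod_j f j x).
Proof.
move=> oU Hf.
have -> : (fun x => \prod_j f j x) = \prod_j f j by apply/funext => x; rewrite fct_prodE.
apply: big_ind => //; last by move=> f1 f2; exact: smooth_onM.
by move=> k; exact: (Ck_on_cst k 1 oU).
Qed.

End SmoothOn.

Section Bump.
Variable R : realType.

(** For j = 0 this is the classical flat function exp (-1/s). The powers of 1/s are carried along so
    that the span of the family is closed under differentiation. *)
Definition flat (j : nat) (s : R) : R := if 0 < s then s ^- j * expR (- s^-1) else 0.

Lemma flat_le0 j s : s <= 0 -> flat j s = 0.
Proof. by rewrite /flat leNgt => /negbTE ->. Qed.

Lemma flat_gt0 j s : 0 < s -> 0 < flat j s.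
Proof. by move=> s0; rewrite /flat s0 mulr_gt0 ?expR_gt0 // invr_gt0 exprn_gt0. Qed.

Lemma flat_ge0 j s : 0 <= flat j s.
Proof. by have [/flat_le0 ->|/flat_gt0/ltW] := leP s 0. Qed.

(* From exp(1/s) = exp(1/(ms))^m >= (1/(ms))^m with m = j + 2. *)
Lemma flat_quadratic j s : flat j s <= j.+2%:R ^+ j.+2 * s ^+ 2.
Proof.
have [s0|s0] := leP s 0; first by rewrite flat_le0 // mulr_ge0 ?sqr_ge0.
rewrite /flat s0 expRN; set m := j.+2.
have m0 : 0 < m%:R :> R by rewrite ltr0n.
have -> : s^-1 = m%:R * (m%:R * s)^-1 by rewrite invfM mulVKf // gt_eqF.
rewrite expRM_natl.
have H : ((m%:R * s)^-1) ^+ m <= expR (m%:R * s)^-1 ^+ m.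
  rewrite lerXn2r ?nnegrE ?expR_ge0 //; first by rewrite invr_ge0 mulr_ge0 ?ltW.
  by apply: le_trans (expR_ge1Dx _); rewrite lerDr.
have p0 : 0 < ((m%:R * s)^-1) ^+ m by rewrite exprn_gt0 // invr_gt0 mulr_gt0.
apply: (@le_trans _ _ (s ^- j * (((m%:R * s)^-1) ^+ m)^-1)).
  rewrite ler_pM2l ?invr_gt0 ?exprn_gt0 // lef_pV2 // posrE ?exprn_gt0 ?expR_gt0 //.
rewrite exprVn invrK exprMn mulrCA ler_pM2l ?exprn_gt0 //.
by rewrite /m -addn2 exprD mulKf // gt_eqF // exprn_gt0.
Qed.

Lemma is_derive_flat j (s : R) :
  is_derive s 1 (flat j) (flat j.+2 s - j%:R * flat j.+1 s).
Proof.
have [s0|s0|->] := ltgtP s 0.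
- rewrite !flat_le0 ?(ltW s0) // mulr0 subr0.
  apply: near_eq_is_derive (is_derive_cst 0 s 1); near=> t; rewrite flat_le0 //.
  by near: t; apply: filterS (lt_nbhsl s0) => t /ltW.
- have sn0 : s != 0 by rewrite gt_eqF.
  pose f (t : R) := (t ^-1) ^+ j * expR (- t^-1).
  have df : is_derive s 1 f (flat j.+2 s - j%:R * flat j.+1 s).
    have dV : is_derive s 1 (fun t : R => t^-1) (- s ^- 2).
      by apply: is_derive_eq (is_deriveV sn0 (is_derive_id s 1)) _; exact: mulr1.
    have dE : is_derive s 1 (fun t : R => expR (- t^-1)) (s ^- 2 * expR (- s^-1)).
      have := @is_derive1_comp R expR (fun t : R => - t^-1) s _ _ (is_derive_expR _)
        (is_deriveN dV).
      by move/is_derive_eq; apply; rewrite opprK mulrC.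
    have dX := @is_deriveX R R (fun t : R => t^-1) j s 1 _ dV.
    have fE : f = (fun t : R => t^-1) ^+ j * (fun t : R => expR (- t^-1)).
      by apply/funext => t; rewrite /f !fctE.
    rewrite fE; apply: is_derive_eq (is_deriveM dX dE) _.
    rewrite /flat s0 /= -![_ *: _]/(_ * _).
    case: j {f fE dX} => [|j]; rewrite ?mulr0n ?mul0r /=.
      by rewrite fctE expr0 mul1r mulr0 subr0 addr0.
    by rewrite fctE -!exprVn; move: s^-1 => v; rewrite !exprS expr0; ring.
  apply: near_eq_is_derive df; near=> t.
  have t0 : 0 < t by near: t; exact: lt_nbhsr.
  by rewrite /f /flat t0 exprVn.
- rewrite !flat_le0 // mulr0 subr0.
  have H : h^-1 *: ((flat j \o shift 0) (h *: 1) - flat j 0) @[h --> 0^'] --> 0.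
    (* By [flat_quadratic] the difference quotient at 0 is bounded by C [|h|]. *)
    apply/cvgrPdist_lt => e e0; pose C : R := j.+2%:R ^+ j.+2.
    have C0 : 0 < C by rewrite exprn_gt0 // ltr0n.
    near=> h.
    have h0 : h != 0 by near: h; exact: nbhs_dnbhs_neq.
    have hC : `|h| < e / C by near: h; apply: dnbhs0_lt; rewrite divr_gt0.
    rewrite /= addr0 [h *: 1]mulr1 [flat j 0]flat_le0 // subr0 sub0r normrN.
    rewrite -[_ *: _]/(_ * _) normrM (ger0_norm (flat_ge0 _ _)) normfV.
    rewrite mulrC ltr_pdivrMr ?normr_gt0 //.
    apply: le_lt_trans (flat_quadratic _ _) _.
    by rewrite -real_normK ?num_real // expr2 mulrA ltr_pM2r ?normr_gt0 // mulrC -ltr_pdivlMr.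
  by split; [apply/cvg_ex; eexists; exact: H|exact: cvg_lim H].
Unshelve. all: by end_near. Qed.

(** Phrased on row vectors of length one, so that [Ck_on_comp] can compose it with affine functions
    of a coordinate. *)
Lemma Ck_flat k j : Ck_on k setT (fun y : 'rV[R]_1 => flat j (y 0 0)).
Proof.
have dfl l (y : 'rV[R]_1) (i : 'I_1) : is_derive y (delta_mx 0 i)
    (fun y : 'rV[R]_1 => flat l (y 0 0)) (flat l.+2 (y 0 0) - l%:R * flat l.+1 (y 0 0)).
  have [dF DF] := is_derive_flat l (y 0 0).
  have E : (fun h : R => h^-1 *: (((fun y : 'rV[R]_1 => flat l (y 0 0)) \o shift y)
      (h *: delta_mx 0 i) - flat l (y 0 0))) =
    (fun h : R => h^-1 *: ((flat l \o shift (y 0 0)) (h *: 1) - flat l (y 0 0))).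
    by apply/funext => h /=; rewrite !mxE (ord1 i) eqxx.
  by split; rewrite /derivable /derive E.
have cfl l : continuous (fun y : 'rV[R]_1 => flat l (y 0 0)).
  move=> y; apply: (@continuous_comp _ _ _ (fun y : 'rV[R]_1 => y 0 0) (flat l)).
    exact: coord_continuous.
  by have [/derivable1_diffP/differentiable_continuous] := is_derive_flat l (y 0 0).
elim: k j => [|k IH] j; first by split=> // y _; exact: cfl.
split=> [y _|i]; first exact: cfl.
split=> [y _|]; first by have [] := dfl j y i.
apply: (@Ck_on_eq _ _ _ _ ((fun y : 'rV[R]_1 => flat j.+2 (y 0 0)) +
    cst (- j%:R) * (fun y : 'rV[R]_1 => flat j.+1 (y 0 0)))); first exact: openT.
  by move=> y _; have [_ ->] := dfl j y i; rewrite fctE /= mulNr.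
apply: Ck_onD => //; first exact: openT.
by apply: Ck_onM => //; [exact: openT|exact/Ck_on_cst/openT].
Qed.

(** Balls of row vectors are cubes, so a product over the coordinates is nonzero exactly on the ball
    of centre a and radius r when r is positive. *)
Definition bump n (a : 'rV[R]_n) (r : R) (y : 'rV[R]_n) : R :=
  \prod_i (flat 0 (r - (y 0 i - a 0 i)) * flat 0 (r + (y 0 i - a 0 i))).

Lemma smooth_bump n (a : 'rV[R]_n) r : smooth_on setT (bump a r).
Proof.
apply: smooth_on_prod => [|i]; first exact: openT.
have aff (s : R) : smooth_on setT
    (fun y : 'rV[R]_n => flat 0 (r + s * (y 0 i - a 0 i))).
  move=> k; have := @Ck_on_comp R 1 n k setT setT _
    (fun y : 'rV[R]_n => \row_(_ < 1) (r + s * (y 0 i - a 0 i)))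
    openT openT (fun _ _ => I) (Ck_flat k 0).
  have -> : (fun y : 'rV[R]_1 => flat 0 (y 0 0)) \o
     (fun y : 'rV[R]_n => \row_(_ < 1) (r + s * (y 0 i - a 0 i))) =
     (fun y : 'rV[R]_n => flat 0 (r + s * (y 0 i - a 0 i))).
    by apply/funext => y; rewrite /= mxE.
  apply=> j; apply: (@Ck_on_eq _ _ _ _ (cst r + cst s * ((fun y => y 0 i) + cst (- a 0 i)))).
  - exact: openT.
  - by move=> y _; rewrite mxE.
  apply: Ck_onD; [exact: openT|exact/Ck_on_cst/openT|].
  apply: Ck_onM; [exact: openT|exact/Ck_on_cst/openT|].
  by apply: Ck_onD; [exact: openT|exact/Ck_on_coord/openT|exact/Ck_on_cst/openT].
apply: smooth_on_eq (smooth_onM openT (aff (-1)) (aff 1)); first exact: openT.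
by move=> y _; rewrite fctE /= mulN1r mul1r.
Qed.

Lemma bump_neq0 n (a : 'rV[R]_n) r y : ball a r y -> bump a r y != 0.
Proof.
move=> [r0 ay]; rewrite gt_eqF //; apply: prodr_gt0 => i _.
have := ay 0 i; rewrite /ball /= ltr_distlC => /andP[h1 h2].
by apply: mulr_gt0; apply: flat_gt0; lra.
Qed.

Lemma bump_eq0 n (a : 'rV[R]_n) r y : 0 < r -> ~ ball a r y -> bump a r y = 0.
Proof.
move=> r0 nay; have [i Hi] : exists i, r <= `|a 0 i - y 0 i|.
  apply: contrapT => /forallNP H; apply: nay; split=> // z i; rewrite (ord1 z) /ball /=.
  by rewrite ltNge; apply/negP; exact: H.
rewrite /bump (bigD1 i) //= [X in X * _](_ : _ = 0) ?mul0r //.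
move: Hi; rewrite leNgt ltr_norml => /nandP[]; rewrite -leNgt => H.
  by rewrite flat_le0 ?mul0r //; lra.
by rewrite [X in _ * X]flat_le0 ?mulr0 //; lra.
Qed.

End Bump.

(** * Hadamard's lemma *)

Section Hadamard.
Variables (R : realType) (n : nat).
Local Notation mu := (@lebesgue_measure R).
Local Notation I01 := (`[0 : R, 1]%classic).
Implicit Types (H F : 'rV[R]_n -> R) (y v : 'rV[R]_n).

Lemma integrable01 (f : R -> R) : {within I01, continuous f} ->
  mu.-integrable I01 (EFin \o f).
Proof. by move=> cf; apply: continuous_compact_integrable => //; exact: segment_compact. Qed.

Lemma within01_sum m (f : 'I_m -> R -> R) (s : seq 'I_m) :
  (forall j, {within I01, continuous (f j)}) ->
  {within I01, continuous (fun t => \sum_(j <- s) f j t)}.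
Proof.
move=> cf; elim: s => [|j s IH].
  have -> : (fun t => \sum_(j <- [::]) f j t) = cst 0 by apply/funext => t; rewrite big_nil.
  by apply: continuous_subspaceT => t; exact: cvg_cst.
have -> : (fun t => \sum_(j <- j :: s) f j t) = f j + (fun t => \sum_(j <- s) f j t).
  by apply/funext => t; rewrite big_cons.
by move=> x; apply: continuousD; [exact: cf|exact: IH].
Qed.

Lemma Rintegral01_sum m (f : 'I_m -> R -> R) :
  (forall j, {within I01, continuous (f j)}) ->
  (\int[mu]_(t in I01) (\sum_j f j t))%R = \sum_j (\int[mu]_(t in I01) f j t)%R.
Proof.
move=> cf; have cs := fun s => @within01_sum _ _ s cf.
elim: (index_enum _) => [|j s IH].
  rewrite big_nil -[RHS](mul0r (fine (mu I01))) -Rintegral_cst //.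
  by apply: eq_Rintegral => t _; rewrite big_nil.
rewrite big_cons -IH -RintegralD //; [|exact: integrable01..].
by apply: eq_Rintegral => t _; rewrite big_cons.
Qed.

Lemma Rintegral01_cst (c : R) : (\int[mu]_(t in I01) c)%R = c.
Proof.
have m1 : mu I01 = 1%E by rewrite lebesgue_measure_itv /= lte01 oppr0 adde0.
by rewrite Rintegral_cst // -[X in fine X]/(mu I01) m1 mulr1.
Qed.

(** Integrand of Hadamard's remainder. The weight t ^ m is there because every derivative in y
    brings out one more factor t, so the family of these integrals is stable under partial
    derivatives. *)
Definition hmul (m : nat) v H (t : R) y : R := t ^+ m * H (v + t *: (y - v)).
Definition hint (m : nat) v H y : R := (\int[mu]_(t in I01) hmul m v H t y)%R.

Variables (a : 'rV[R]_n) (r : R) (v : 'rV[R]_n).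
Local Notation B := (ball a r).
Hypothesis Bv : B v.

Lemma seg_ball y (t : R) : B y -> I01 t -> B (v + t *: (y - v)).
Proof.
move=> [r0 ay]; rewrite /= in_itv /= => /andP[t0 t1]; split=> // k i.
have [_ av] := Bv; move: (ay k i) (av k i); rewrite (ord1 k) /ball /= !mxE.
rewrite !ltr_distl => /andP[h1 h2] /andP[h3 h4].
have cv (x z : R) : 0 < x -> 0 < z -> 0 < (1 - t) * x + t * z.
  move=> x0 z0; have [->|tn1] := eqVneq t 1; first by lra.
  by have : t < 1 by [rewrite lt_neqAle tn1]; nra.
have := cv _ _ (_ : 0 < a 0 i - v 0 i + r) (_ : 0 < a 0 i - y 0 i + r).
have := cv _ _ (_ : 0 < v 0 i + r - a 0 i) (_ : 0 < y 0 i + r - a 0 i).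
move=> H1 H2; have {}H1 := H1 ltac:(lra) ltac:(lra); have {}H2 := H2 ltac:(lra) ltac:(lra).
by apply/andP; split; lra.
Qed.

Lemma hmul_jcont m H y (t : R) : {for v + t *: (y - v), continuous H} ->
  {for (t, y), continuous (fun p : R * 'rV[R]_n => hmul m v H p.1 p.2)}.
Proof.
move=> cH.
apply: (@continuousM R _ (fun p : R * 'rV[R]_n => p.1 ^+ m)
  (fun p => H (v + p.1 *: (p.2 - v)))).
  apply: (@continuous_comp _ _ _ fst (fun t : R => t ^+ m)); first exact: cvg_fst.
  exact: exprn_continuous.
apply: (@continuous_comp _ _ _ (fun p : R * 'rV[R]_n => v + p.1 *: (p.2 - v)) H) => //.
apply: cvgD; first exact: cvg_cst.
apply: cvgZ; first exact: cvg_fst.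
by apply: cvgB; [exact: cvg_snd|exact: cvg_cst].
Qed.

Lemma hmul_within m H y : (forall x, B x -> {for x, continuous H}) -> B y ->
  {within I01, continuous (fun t => hmul m v H t y)}.
Proof.
move=> cH By; apply: continuous_in_subspaceT => t; rewrite inE => t01.
apply: (@continuous_comp _ _ _ (fun t : R => (t, y)) (fun p => hmul m v H p.1 p.2)).
  by apply: (@cvg_pair _ _ _ (nbhs t) (nbhs t) (nbhs y) _ _ (nbhs_filter y));
    [exact: cvg_id|exact: cvg_cst].
exact/hmul_jcont/cH/seg_ball.
Qed.

(** Joint continuity becomes uniform in t by compactness of [0, 1]. Both z and y are compared with
    the value at a fixed (t, y), whence the halves of e. *)
Lemma hmul_unif m H y (e : R) : (forall x, B x -> {for x, continuous H}) -> B y ->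
  0 < e -> exists2 d, 0 < d & forall z t, ball y d z -> I01 t ->
    `|hmul m v H t z - hmul m v H t y| < e.
Proof.
move=> cH By e0; have e20 : 0 < e / 2 by rewrite divr_gt0.
have /nbhs_ballP[d /= d0 dP] : nbhs y
    (fun z => I01 `<=` (fun t => `|hmul m v H t z - hmul m v H t y| < e)).
  apply: (proj1 (compact_near_coveringP I01) (@segment_compact R 0 1) _ (nbhs y) _
    (nbhs_filter y)).
  move=> t t01; have := hmul_jcont (m := m) (cH _ (seg_ball By t01)).
  move=> /cvgrPdist_lt/(_ _ e20) [[/= P Q] [/= Pt Qy] PQ].
  exists (P, Q) => //= -[s z] [/= Ps Qz].
  have h1 := PQ (s, z) (conj Ps Qz).
  have h2 := PQ (s, y) (conj Ps (nbhs_singleton Qy)).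
  rewrite (splitr e) -(subrKA (hmul m v H t y)) (le_lt_trans (ler_normD _ _)) //.
  by rewrite ltrD // distrC.
by exists d => // z t zd t01; exact: dP.
Qed.

Lemma hint_continuous m H y : (forall x, B x -> {for x, continuous H}) -> B y ->
  {for y, continuous (hint m v H)}.
Proof.
move=> cH By; apply/cvg_rV_ballP => e e0.
have e20 : 0 < e / 2 by rewrite divr_gt0.
have [d d0 dP] := hmul_unif m cH By e20.
have /nbhs_ballP[d' /= d'0 d'B] : nbhs y B.
  by apply: open_nbhs_nbhs; split=> //; exact: ball_open.
exists (Num.min d d'); first by rewrite lt_min d0.
move=> z zy.
have Bz : B z by apply: d'B; apply: le_ball zy; rewrite ge_min lexx orbT.
have zd : ball y d z by apply: le_ball zy; rewrite ge_min lexx.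
have iy := integrable01 (hmul_within (m := m) cH By).
have iz := integrable01 (hmul_within (m := m) cH Bz).
rewrite /hint -RintegralB //.
apply: le_lt_trans (le_normr_Rintegral _ _) _ => //.
  by under [X in integrable _ _ X]eq_fun do rewrite EFinB; exact: integrableB.
apply: (@le_lt_trans _ _ (e / 2)); last by rewrite ltr_pdivrMr // ltr_pMr // ltr1n.
rewrite -[leRHS]Rintegral01_cst; apply: le_Rintegral => //.
- apply: (integrable_norm).
  by under [X in integrable _ _ X]eq_fun do rewrite EFinB; exact: integrableB.
- by apply: integrable01; apply: continuous_subspaceT => t; exact: cvg_cst.
by move=> t t01; rewrite distrC ltW // dP.
Qed.

Lemma hint_is_derive m H y (j : 'I_n) :
  (forall x, B x -> {for x, continuous H}) ->
  (forall x, B x -> derivable H x (delta_mx 0 j)) ->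
  (forall x, B x -> {for x, continuous ('D_(delta_mx 0 j) H)}) -> B y ->
  is_derive y (delta_mx 0 j) (hint m v H) (hint m.+1 v ('D_(delta_mx 0 j) H) y).
Proof.
move=> cH dH cD By; set e := delta_mx 0 j; pose D := 'D_e H.
(* Tolerance 1 here gives the constant dominating function used below: the maximum over t of the
   differentiated integrand at y, plus 1. *)
have [d1 d10 d1P] := hmul_unif m.+1 cD By ltr01.
have /nbhs_ballP[d2 /= d20 d2B] : nbhs y B.
  by apply: open_nbhs_nbhs; split=> //; exact: ball_open.
pose d := Num.min d1 d2; have d0 : 0 < d by rewrite lt_min d10.
have yd (h : R) : `](- d), d[%classic h -> ball y d (y + h *: e).
  rewrite /= in_itv /= => hd; split=> // k i; rewrite (ord1 k) /ball /= !mxE eqxx /=.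
  rewrite opprD addrA subrr sub0r normrN normrM; apply: le_lt_trans (_ : `|h| < d).
    by case: (i == j); rewrite /= ?normr1 ?mulr1 // normr0 mulr0.
  by rewrite ltr_norml.
have Bh (h : R) : `](- d), d[%classic h -> B (y + h *: e).
  by move=> /yd hd; apply: d2B; apply: le_ball hd; rewrite ge_min lexx orbT.
pose f (h t : R) := hmul m v H t (y + h *: e).
have df (h t : R) : `](- d), d[%classic h -> I01 t ->
    is_derive h 1 (f ^~ t) (hmul m.+1 v D t (y + h *: e)).
  move=> hd t01; pose w := v + t *: (y - v).
  have wE (s : R) : v + t *: (y + s *: e - v) = w + (t * s) *: e.
    by rewrite /w -scalerA -[RHS]addrA -scalerDr addrAC.
  have fE : f ^~ t = cst (t ^+ m) * ((fun s : R => H (w + s *: e)) \o (fun s => t * s)).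
    by apply/funext => s; rewrite /f /hmul wE.
  have dl : is_derive (t * h) 1 (fun s : R => H (w + s *: e)) (D (w + (t * h) *: e)).
    by apply: is_derive_line; rewrite -wE; apply/dH/seg_ball => //; exact: Bh.
  have dt : is_derive h 1 (fun s : R => t * s) t.
    by apply: is_derive_eq (is_deriveZ t (is_derive_id h 1)) _; exact: mulr1.
  rewrite fE; apply: is_derive_eq (is_deriveM (is_derive_cst _ _ _) (is_derive1_comp dl dt)) _.
  rewrite scaler0 addr0 /hmul -/D wE exprSr.
  by rewrite -[LHS]/(_ * (_ * _)) mulrA mulrAC.
have [c c01 cP] : exists2 c, c \in `[0 : R, 1] & forall t, t \in `[0 : R, 1] ->
    `|hmul m.+1 v D t y| <= `|hmul m.+1 v D c y|.
  apply: (@EVT_max R (fun t => `|hmul m.+1 v D t y|)) => //.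
  move=> t; apply: (@continuous_comp _ _ _ (fun t : subspace I01 => hmul m.+1 v D t y)).
    exact: hmul_within.
  exact: norm_continuous.
have := @cvg_differentiation_under_integral R _ _ mu f I01 (measurable_itv _) 0 (- d) d _ _ _
  (cst (`|hmul m.+1 v D c y| + 1)).
have d00 : `](- d), d[%classic 0 by rewrite /= in_itv /= oppr_lt0 d0.
move=> /(_ d00 _ _ _ _ _) H1.
have {}H1 := H1
  ltac:(by move=> h hd; apply: integrable01; apply: hmul_within => //; exact: Bh)
  ltac:(by move=> h t hd t01; have [] := df h t hd t01)
  ltac:(by move=> t; apply: addr_ge0).
have {H1} := H1
  ltac:(by apply: integrable01; apply: continuous_subspaceT => t; exact: cvg_cst).
have D1 (h t : R) : `](- d), d[%classic h -> I01 t ->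
    partial1of2 f h t = hmul m.+1 v D t (y + h *: e).
  by move=> hd t01; rewrite partial1of2E; have [_ ->] := df h t hd t01.
move=> H1; have {H1} := H1 ltac:(
  move=> h t hd t01; rewrite D1 //= -lerBlDl; apply: le_trans (ltW (d1P (y + h *: e) t _ t01));
  [ apply: le_trans (lerB_dist _ _); apply: lerB => //; exact: cP
  | by apply: le_ball (yd _ hd); rewrite ge_min lexx]).
have I1 : (\int[mu]_(t in I01) partial1of2 f 0 t)%R = hint m.+1 v D y.
  by apply: eq_Rintegral => t; rewrite inE => t01; rewrite D1 // scale0r addr0.
rewrite I1 => H1.
have E : (fun h : R => h^-1 *: ((hint m v H \o shift y) (h *: e) - hint m v H y)) =
  (fun h : R => h^-1 *: ((\int[mu]_(t in I01) f (h + 0) t)%R - (\int[mu]_(t in I01) f 0 t)%R)).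
  by apply/funext => h; rewrite /f addr0 scale0r addr0 /= [h *: e + y]addrC.
by split; rewrite /derivable /derive E; [apply/cvg_ex; eexists; exact: H1|exact: cvg_lim H1].
Qed.

Lemma smooth_hint m H : smooth_on B H -> smooth_on B (hint m v H).
Proof.
move=> sH k; elim: k m H sH => [|k IH] m H sH.
  split=> // y By; apply: hint_continuous => // x Bx; exact: smooth_on_continuous sH Bx.
have dd j y (By : B y) : is_derive y (delta_mx 0 j) (hint m v H)
    (hint m.+1 v ('D_(delta_mx 0 j) H) y).
  apply: hint_is_derive => // x Bx; first exact: smooth_on_continuous sH Bx.
    exact: smooth_on_derivable sH Bx.
  exact: smooth_on_continuous (smooth_on_derive j sH) Bx.
split=> [y By|j].
  by apply: hint_continuous => // x Bx; exact: smooth_on_continuous sH Bx.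
split=> [y By|]; first by have [] := dd j y By.
apply: Ck_on_eq (IH m.+1 _ (smooth_on_derive j sH)); first exact: ball_open.
by move=> y By; have [_ ->] := dd j y By.
Qed.

(** The fundamental theorem of calculus along the segment from v to y, with g_j the integral of the
    j-th partial derivative over that segment. The base point v is any point of the ball, since
    [bump_frame] expands a function at every point where the bump is nonzero. *)
Lemma hadamard F : smooth_on B F ->
  exists g : 'I_n -> 'rV[R]_n -> R,
    [/\ forall j, smooth_on B (g j),
        forall y, B y -> F y - F v = \sum_j (y 0 j - v 0 j) * g j y &
        forall j, g j v = 'D_(delta_mx 0 j) F v].
Proof.
move=> sF; pose D j := 'D_(delta_mx 0 j) F.
have cD j x : B x -> {for x, continuous (D j)}.
  by move=> Bx; exact: smooth_on_continuous (smooth_on_derive j sF) Bx.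
exists (fun j => hint 0 v (D j)); split=> [j|y By|j].
- exact/smooth_hint/smooth_on_derive.
- pose G (t : R) := F (v + t *: (y - v)).
  pose dG (t : R) := \sum_j (y 0 j - v 0 j) * hmul 0 v (D j) t y.
  have dGP (t : R) : I01 t -> is_derive t 1 G (dG t).
    move=> t01; have Bt := seg_ball By t01.
    have := @C1_chain R n R B F (fun s : R => v + s *: (y - v)) (fun j => y 0 j - v 0 j) t 1
      (ball_open _ _) (sF 1%N) Bt.
    move=> H1; have {}H1 := H1 _.
    have {H1} : is_derive t 1 G (\sum_j D j (v + t *: (y - v)) * (y 0 j - v 0 j)).
      apply: H1 => j.
      have E : (fun s : R => (v + s *: (y - v)) 0 j) = cst (v 0 j) + (y 0 j - v 0 j) *: id.
        by apply/funext => s; rewrite !mxE fctE mulrC.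
      rewrite E; apply: is_derive_eq
        (is_deriveD (is_derive_cst _ _ _) (is_deriveZ _ (is_derive_id t 1))) _.
      by rewrite add0r; exact: mulr1.
    move=> H1; apply: is_derive_eq H1 _; apply: eq_bigr => j _.
    by rewrite /hmul expr0 mul1r mulrC.
  have cdG j : {within I01, continuous (fun t => (y 0 j - v 0 j) * hmul 0 v (D j) t y)}.
    move=> t; apply: (@cvgM R (subspace I01) _ _ (cst (y 0 j - v 0 j))
      (fun t => hmul 0 v (D j) t y)).
      exact: cvg_cst.
    by apply: hmul_within => // x; exact: cD.
  have cG (t : R) : I01 t -> {for t, continuous G}.
    by move=> /dGP[/derivable1_diffP/differentiable_continuous].
  have oo01 (t : R) : t \in `]0, 1[ -> I01 t by exact: subset_itv_oo_cc.
  have FTC : (\int[mu]_(t in I01) dG t)%R = G 1 - G 0.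
    rewrite /Rintegral (@continuous_FTC2 R dG G 0 1 ltr01) //.
    - exact: within01_sum.
    - split=> [t /oo01/dGP[]//||].
        by apply: cvg_at_right_filter; apply: cG; rewrite /= in_itv /= lexx ler01.
      by apply: cvg_at_left_filter; apply: cG; rewrite /= in_itv /= lexx ler01.
    - by move=> t /oo01/dGP[_ <-]; rewrite derive1E.
  have <- : G 1 = F y by rewrite /G scale1r addrC subrK.
  have <- : G 0 = F v by rewrite /G scale0r addr0.
  rewrite -FTC Rintegral01_sum //; apply: eq_bigr => j _.
  by rewrite RintegralZl //; apply/integrable01/hmul_within => // x; exact: cD.
- rewrite /hint -[RHS]Rintegral01_cst; apply: eq_Rintegral => t _.
  by rewrite /hmul expr0 mul1r subrr scaler0 addr0.
Qed.

End Hadamard.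

(** * Local frames of the module of vector fields *)

Section Manifold.
Variables (R : realType) (n : nat) (M : manifold R n).
Local Notation A := (Cinf M).

Lemma chart_img (c : chart R n M) y : (cmap c @` cdom c) y ->
  cdom c (cinv c y) /\ cmap c (cinv c y) = y.
Proof. by move=> [q Dq <-]; rewrite (cmapK Dq). Qed.

Lemma open_pullback (c : chart R n M) (W : set M) : open W ->
  open [set y | (cmap c @` cdom c) y /\ W (cinv c y)].
Proof.
move=> oW; rewrite openE => y [Uy Wy]; apply: filterI.
  by apply: open_nbhs_nbhs; split=> //; exact: cimg_open.
by apply: (cinv_continuous Uy); apply: open_nbhs_nbhs.
Qed.

Lemma open_chart_pre (c : chart R n M) (V : set 'rV[R]_n) : open V ->
  open [set q | cdom c q /\ V (cmap c q)].
Proof.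
move=> oV; rewrite openE => q [Dq Vq]; apply: filterI.
  by apply: open_nbhs_nbhs; split=> //; exact: cdom_open.
by apply: (cmap_continuous Dq); apply: open_nbhs_nbhs.
Qed.

(** [smooth] quantifies over all charts, but near each point one suffices: the expression in another
    chart is obtained by composing with the smooth transition map. *)
Lemma smooth_local (f : M -> R) :
  (forall q, exists c V, [/\ matlas c, cdom c q, open V, V (cmap c q) &
     V `<=` cmap c @` cdom c /\ smooth_on V (f \o cinv c)]) -> smooth f.
Proof.
move=> H d Md; apply: smooth_on_local => y [q Dq <-].
have [c [V [Mc cq oV Vq [VU sf]]]] := H q.
pose W := [set z | (cmap d @` cdom d) z /\ [set q | cdom c q /\ V (cmap c q)] (cinv d z)].
have oW : open W by apply: open_pullback; exact: open_chart_pre.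
exists W; split=> //; first by split; [exists q|rewrite (cmapK Dq)].
move=> k; apply: (@Ck_on_eq _ _ _ _ ((f \o cinv c) \o (fun z => cmap c (cinv d z)))) => //.
  by move=> z [_ [cz _]] /=; rewrite cmapK.
apply: (@Ck_on_comp _ _ _ _ _ V) => // [z [_ []]//|j].
have := matlas_compatible Md Mc j; move/smooth_on_sub; apply=> z [[x dx <-] []].
by rewrite (cmapK dx) => cx _; exists x.
Qed.

Lemma cinf_sumE (I : Type) (s : seq I) (F : I -> A) x :
  (\sum_(i <- s) F i) x = \sum_(i <- s) F i x.
Proof. by elim: s => [|i s IH]; rewrite ?big_nil // !big_cons -IH. Qed.

Lemma vf_ccst (X : vfield M) a : X (ccst M a) = 0.
Proof.
have X1 : X 1 = 0.
  have := vfM X 1 1; rewrite !mulr1 mul1r => E.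
  by apply: (addrI (X 1)); rewrite addr0 -E.
have -> : ccst M a = ccst M a * 1 by rewrite mulr1.
by rewrite vfZ X1 mulr0.
Qed.

Lemma vf_sum (X : vfield M) (I : Type) (s : seq I) (F : I -> A) :
  X (\sum_(i <- s) F i) = \sum_(i <- s) X (F i).
Proof.
have X0 : X 0 = 0 by apply: (addrI (X 0)); rewrite -vfD !addr0.
by elim: s => [|i s IH]; rewrite ?big_nil // !big_cons vfD IH.
Qed.

Lemma vfield_sumE (I : Type) (s : seq I) (F : I -> vfield M) f :
  (\sum_(i <- s) F i) f = \sum_(i <- s) F i f.
Proof. by elim: s => [|i s IH]; rewrite ?big_nil // !big_cons -IH. Qed.

(** * Functions and vector fields cut off inside a chart *)

Section ChartBump.
Variables (c : chart R n M) (a : 'rV[R]_n) (r rho : R).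
Hypotheses (Mc : matlas c) (r0 : 0 < r) (rrho : r < rho).
Local Notation U := (cmap c @` cdom c).
Local Notation V := (ball a rho).
Hypothesis VU : V `<=` U.
Implicit Types (F : 'rV[R]_n -> R).

Definition bump_ext F (q : M) : R :=
  if `[< cdom c q >] then bump a r (cmap c q) * F (cmap c q) else 0.

Lemma bump_extE F q : cdom c q -> bump_ext F q = bump a r (cmap c q) * F (cmap c q).
Proof. by move=> Dq; rewrite /bump_ext asboolT. Qed.

Lemma bump_ext_out F q : ~ (cdom c q /\ ball a r (cmap c q)) -> bump_ext F q = 0.
Proof.
move=> H; rewrite /bump_ext; case: asboolP => // Dq.
by rewrite bump_eq0 ?mul0r // => bq; apply: H.
Qed.

(** The two radii leave room for the closed cube of radius r inside V. Its image in M is compact,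
    hence closed because M is Hausdorff, and the extension vanishes on the open complement. A point
    is either in the part of the chart over V or in that complement. *)
Lemma smooth_bump_ext F : smooth_on V F -> smooth (bump_ext F).
Proof.
move=> sF; apply: smooth_local => q.
have [[cq Vq]|nVq] := pselect (cdom c q /\ V (cmap c q)).
  exists c, V; split=> //; [exact: ball_open|split=> //].
  apply: (@smooth_on_eq _ _ _ (bump a r * F)); first exact: ball_open.
    by move=> y /VU/chart_img[Dy Ey]; rewrite /= bump_extE // Ey.
  apply: smooth_onM => //; first exact: ball_open.
  exact: smooth_on_sub (smooth_bump a r).
pose box := [set y : 'rV[R]_n | forall i, `[a 0 i - r, a 0 i + r]%classic (y 0 i)].
have ballbox y : ball a r y -> box y.
  move=> [_ ay] i; have := ay 0 i; rewrite /ball /= in_itv /= ltr_distlC.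
  by move=> /andP[h1 h2]; rewrite !ltW.
have boxV : box `<=` V.
  move=> y by_; split; first exact: lt_trans rrho.
  move=> k i; rewrite (ord1 k); have := by_ i; rewrite /ball /= in_itv /= => /andP[h1 h2].
  by rewrite ltr_distlC (lt_le_trans _ h1) ?(le_lt_trans h2) ?ltrD2l ?ltrN2.
have cK : closed (cinv c @` box).
  apply: compact_closed; first exact: m_hausdorff.
  apply: continuous_compact; last first.
    exact: (@rV_compact R n (fun i => `[a 0 i - r, a 0 i + r]%classic)
      (fun i => @segment_compact R _ _)).
  apply: continuous_in_subspaceT => y; rewrite inE => by_.
  by apply: cinv_continuous; apply/VU/boxV.
have [d Md dq] := matlas_cover q.
exists d, [set z | (cmap d @` cdom d) z /\ (~` (cinv c @` box)) (cinv d z)].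
split=> //; first by apply: open_pullback; rewrite openC.
  split; first by exists q.
  rewrite (cmapK dq) => -[y by_ yq]; apply: nVq.
  have [h1 h2] := chart_img (VU (boxV _ by_)).
  by rewrite -yq h2; split=> //; exact: boxV.
split=> [z []//|].
apply: (@smooth_on_eq _ _ _ (cst 0)).
- by apply: open_pullback; rewrite openC.
- move=> z [_ nz]; rewrite /= bump_ext_out // => -[cz bz]; apply: nz.
  by exists (cmap c (cinv d z)); [exact: ballbox|rewrite cmapK].
- by move=> k; apply: Ck_on_cst; apply: open_pullback; rewrite openC.
Qed.

Definition cext F (sF : smooth_on V F) : A := MkCinf (smooth_bump_ext sF).

Lemma smooth_cinf (f : A) : smooth_on U (f \o cinv c).
Proof. exact: cfun_smooth. Qed.

Definition pder (i : 'I_n) (f : A) : A :=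
  cext (smooth_on_derive i (smooth_on_sub VU (smooth_cinf f))).

Lemma pderE i f q : cdom c q ->
  pder i f q = bump a r (cmap c q) * 'D_(delta_mx 0 i) (f \o cinv c) (cmap c q).
Proof. by move=> Dq; rewrite /= bump_extE. Qed.

Lemma pder_out i f q : ~ cdom c q -> pder i f q = 0.
Proof. by move=> Dq; apply: bump_ext_out => -[]. Qed.

Let derU i (f : A) q : cdom c q -> derivable (f \o cinv c) (cmap c q) (delta_mx 0 i).
Proof. by move=> Dq; apply: smooth_on_derivable (smooth_cinf f) _; exists q. Qed.

Fact pder_D i f g : pder i (f + g) = pder i f + pder i g.
Proof.
apply: cinf_eq => q; rewrite cinf_addE.
have [Dq|Dq] := pselect (cdom c q); last by rewrite !pder_out // addr0.
by rewrite !pderE // -mulrDr -deriveD //; exact: derU.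
Qed.

Fact pder_M i f g : pder i (f * g) = pder i f * g + f * pder i g.
Proof.
apply: cinf_eq => q; rewrite cinf_addE !cinf_mulE.
have [Dq|Dq] := pselect (cdom c q); last by rewrite !pder_out // mul0r mulr0 addr0.
rewrite !pderE // [LHS](_ : _ = bump a r (cmap c q) *
  'D_(delta_mx 0 i) ((f \o cinv c) * (g \o cinv c)) (cmap c q)) //.
rewrite deriveM; [|exact: derU..].
rewrite /= (cmapK Dq) -![_ *: _]/(_ * _); ring.
Qed.

Fact pder_Z i k f : pder i (ccst M k * f) = ccst M k * pder i f.
Proof.
rewrite pder_M; have -> : pder i (ccst M k) = 0; last by rewrite mul0r add0r.
apply: cinf_eq => q; have [Dq|Dq] := pselect (cdom c q); last by rewrite !pder_out.
by rewrite pderE // [X in 'D__ X _](_ : _ = cst k) // derive_cst mulr0.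
Qed.

Definition pfield i : vfield M := MkVfield (pder_D i) (pder_Z i) (pder_M i).

Fact smooth_one : smooth_on V (cst 1).
Proof. by move=> k; apply/Ck_on_cst/ball_open. Qed.
Fact smooth_coord (i : 'I_n) : smooth_on V (fun y : 'rV[R]_n => y 0 i).
Proof. by move=> k; apply/Ck_on_coord/ball_open. Qed.

Local Notation psi := (cext smooth_one).
Local Notation Y i := (cext (smooth_coord i)).

(* Hadamard's lemma at q, multiplied by psi^3, becomes an identity between global
   functions, to which the derivation X can be applied. *)
Lemma bump_frame (X : vfield M) (f : A) :
  psi * psi * psi * psi * X f =
  \sum_i (X (Y i) * (psi * psi) - X psi * (Y i * psi)) * pfield i f.
Proof.
apply: cinf_eq => q.
rewrite cinf_sumE.
have [[Dq bq]|nq] := pselect (cdom c q /\ ball a r (cmap c q)); last first.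
  have psi0 : psi q = 0 by exact: bump_ext_out.
  rewrite !cinf_mulE psi0 !mul0r big1 // => i _.
  by rewrite cinf_mulE cinf_addE cinf_oppE !cinf_mulE psi0 !mulr0 oppr0 addr0 mul0r.
set v := cmap c q; pose F := f \o cinv c.
have Vv : V v by apply: le_ball bq; exact: ltW.
have [g [sg gE gv]] := hadamard Vv (smooth_on_sub VU (smooth_cinf f)).
pose G i : A := cext (sg i).
have key : psi * psi * psi * (f - ccst M (f q)) =
    \sum_i (Y i - ccst M (v 0 i) * psi) * (G i * psi).
  apply: cinf_eq => x; rewrite cinf_sumE.
  have [[Dx bx]|nx] := pselect (cdom c x /\ ball a r (cmap c x)); last first.
    have psi0 : psi x = 0 by exact: bump_ext_out.
    rewrite !cinf_mulE psi0 !mul0r big1 // => i _.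
    by rewrite !cinf_mulE psi0 !mulr0.
  have Vx : V (cmap c x) by apply: le_ball bx; exact: ltW.
  rewrite !cinf_mulE cinf_addE cinf_oppE /= !bump_extE //=.
  have := gE _ Vx; rewrite /= (cmapK Dx) (cmapK Dq) => ->.
  rewrite mulr_sumr; apply: eq_bigr => i _.
  by rewrite !fctE !bump_extE //=; ring.
have psiq : psi q = bump a r v by rewrite /= bump_extE // mulr1.
(* With q fixed, f - f(q) and every [Y i] - v_i [psi] vanish at q, so by the Leibniz rule only the
   terms where X hits these factors survive. *)
have Xkey := congr1 (fun h : A => (X h : A) q) key.
move: Xkey; rewrite vfM vfD vfN vf_ccst vf_sum subr0 cinf_sumE.
rewrite cinf_addE !cinf_mulE cinf_addE cinf_oppE subrr mulr0 add0r => Xkey.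
(* The fourth factor [psi] turns the constant v_i into the global function [Y i], which makes the
   coefficients independent of q. *)
rewrite [LHS](_ : _ = psi q * (psi q * psi q * psi q * X f q)); last by ring.
rewrite Xkey mulr_sumr; apply: eq_bigr => i _.
rewrite vfM vfD vfN vfM vf_ccst.
rewrite !(cinf_addE, cinf_mulE, cinf_oppE) cinf_0E psiq.
have -> : Y i q = bump a r v * v 0 i by rewrite /= bump_extE.
have -> : G i q = bump a r v * 'D_(delta_mx 0 i) F v by rewrite /= bump_extE // gv.
have -> : pfield i f q = bump a r v * 'D_(delta_mx 0 i) F v by exact: pderE.
rewrite /=; ring.
Qed.

End ChartBump.

(** The coefficients of [bump_frame] are linear in X applied to the n functions [Y i] and to [psi].
    The terms with X [psi] are gathered into one extra pair, which accounts for the size n + 1. *)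
Lemma local_frame (p : M) : exists (chi : A) (s : seq (A * vfield M)),
  [/\ chi p != 0, size s = n.+1 &
      forall X : vfield M, chi *: X = \sum_(g <- s) X g.1 *: g.2].
Proof.
have [c Mc Dp] := matlas_cover p; set a := cmap c p.
have /nbhs_ballP[rho /= rho0 VU] : nbhs a (cmap c @` cdom c).
  by apply: open_nbhs_nbhs; split; [exact: cimg_open|exists p].
have r0 : 0 < rho / 2 by rewrite divr_gt0.
have rrho : rho / 2 < rho by rewrite ltr_pdivrMr // ltr_pMr // ltr1n.
pose psi := cext Mc r0 rrho VU (@smooth_one a rho).
pose Y i := cext Mc r0 rrho VU (@smooth_coord a rho i).
pose D i := pfield Mc r0 rrho VU i.
exists (psi * psi * psi * psi), ((psi, - \sum_i (Y i * psi) *: D i) ::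
  [seq (Y i, (psi * psi) *: D i) | i <- enum 'I_n]); split.
- have b0 : psi p != 0.
    by rewrite /= bump_extE // mulr1 bump_neq0 //; exact: ballxx.
  by rewrite !cinf_mulE !mulf_neq0.
- by rewrite /= size_map size_enum_ord.
- move=> X; apply: vfield_eq => f; rewrite big_cons big_map big_enum /=.
  rewrite bump_frame !vfield_sumE mulrN mulr_sumr addrC -sumrB.
  by apply: eq_bigr => i _; rewrite !vfield_scaleE mulrBl !mulrA.
Qed.

End Manifold.

(** * Contractions and frames in the algebra of alternating forms *)

Lemma not_uniq_split (T : eqType) (s : seq T) : ~~ uniq s ->
  exists x s1 s2 s3, s = s1 ++ x :: s2 ++ x :: s3.
Proof.
elim: s => //= y s IH; rewrite negb_and negbK => /orP[|/IH].
  by case/splitPr => s1 s2; exists y, [::], s1, s2.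
by move=> [x [s1 [s2 [s3 ->]]]]; exists x, (y :: s1), s2, s3.
Qed.

Section AltAlgebra.
Variables (K : comPzRingType) (T : lmodType K).
Implicit Types (P Q : altform T) (f : K) (u v : T) (s : seq T).

Lemma altform_sumE (I : Type) (r : seq I) (F : I -> altform T) s :
  (\sum_(i <- r) F i) s = \sum_(i <- r) F i s.
Proof. by elim: r => [|i r IH]; rewrite ?big_nil // !big_cons -IH. Qed.

Lemma altform_lin_sum P s1 s2 (I : Type) (r : seq I) (c : I -> K) (e : I -> T) :
  P (s1 ++ (\sum_(i <- r) c i *: e i) :: s2) =
  \sum_(i <- r) c i * P (s1 ++ e i :: s2).
Proof.
elim: r => [|i r IH]; rewrite ?big_nil ?big_cons ?wfun_lin ?IH //.
have := wfun_lin P s1 s2 0 0 0; rewrite scaler0 addr0 mul0r add0r => ->.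
by have := wfun_lin P s1 s2 (-1) 0 0; rewrite scaler0 addr0 mulN1r addNr.
Qed.

Lemma altformZ P s1 s2 f u : P (s1 ++ (f *: u) :: s2) = f * P (s1 ++ u :: s2).
Proof.
have := @altform_lin_sum P s1 s2 _ [:: tt] (fun=> f) (fun=> u).
by rewrite !big_seq1.
Qed.

Lemma altform_swap P u v s : P (u :: v :: s) = - P (v :: u :: s).
Proof.
apply/eqP; rewrite -addr_eq0.
have lD x y z s' : P [:: x + y, z & s'] = P [:: x, z & s'] + P [:: y, z & s'].
  by have := wfun_lin P [::] (z :: s') 1 x y; rewrite scale1r mul1r.
have rD x y z s' : P [:: z, x + y & s'] = P [:: z, x & s'] + P [:: z, y & s'].
  by have := wfun_lin P [:: z] s' 1 x y; rewrite scale1r mul1r.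
have := wfun_alt P [::] [::] s (u + v); rewrite /= lD !rD.
rewrite (wfun_alt P [::] [::] s u) (wfun_alt P [::] [::] s v).
by rewrite add0r addr0 => ->.
Qed.

Fact contr_lin u P : wlin (wcontr u P). Proof. exact/wlin_contr/wfun_lin. Qed.
Fact contr_alt u P : walt (wcontr u P). Proof. exact/walt_contr/wfun_alt. Qed.
Definition contr u P : altform T := MkAltform (contr_lin u P) (contr_alt u P).

Lemma homog_contr k u P : homog k.+1 P -> homog k (contr u P).
Proof. by move=> HP s sk; apply: HP. Qed.

Lemma wedge_fun_cst f (Q : seq T -> K) s : wedge_fun (@wcst_fun K T f) Q s = f * Q s.
Proof.
elim: s f Q => [|u s IH] f Q //=.
have -> : wcontr u (@wcst_fun K T f) = (fun=> 0) by [].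
have -> : winvol (@wcst_fun K T f) = @wcst_fun K T f.
  by apply/funext => -[|v z]; rewrite /winvol /= ?expr0 ?mul1r ?mulr0.
by rewrite wedge_fun0l IH add0r.
Qed.

Lemma wedge_cst f Q : wedge (wcst T f) Q = f *: Q.
Proof. by apply: altform_eq => s; exact: wedge_fun_cst. Qed.

Lemma wedge_cstr P f : wedge P (wcst T f) = f *: P.
Proof.
apply: altform_eq => s; rewrite -[LHS]/(wedge_fun P (@wcst_fun K T f) s) -[RHS]/(f * P s).
elim: s {P} (wfun P) => [|u s IH] P /=; first exact: mulrC.
have -> : wcontr u (@wcst_fun K T f) = (fun=> 0) by [].
by rewrite wedge_fun0r addr0 IH.
Qed.

Lemma wedge_lin_l f P P' Q : wedge (f *: P + P') Q = f *: wedge P Q + wedge P' Q.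
Proof. by apply: altform_eq => s; exact: wedge_fun_linl. Qed.
Lemma wedge_lin_r f P Q Q' : wedge P (f *: Q + Q') = f *: wedge P Q + wedge P Q'.
Proof. by apply: altform_eq => s; exact: wedge_fun_linr. Qed.
Lemma wedge0l Q : wedge 0 Q = 0.
Proof. by apply: altform_eq => s; exact: wedge_fun0l. Qed.
Lemma wedge0r P : wedge P 0 = 0.
Proof. by apply: altform_eq => s; exact: wedge_fun0r. Qed.
Lemma wedgeZl f P Q : wedge (f *: P) Q = f *: wedge P Q.
Proof. by rewrite -[f *: P]addr0 wedge_lin_l wedge0l addr0. Qed.
Lemma wedgeZr f P Q : wedge P (f *: Q) = f *: wedge P Q.
Proof. by rewrite -[f *: Q]addr0 wedge_lin_r wedge0r addr0. Qed.

Lemma wedgeNl P Q : wedge (- P) Q = - wedge P Q.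
Proof. by rewrite -scaleN1r wedgeZl scaleN1r. Qed.
Lemma wedgeNr P Q : wedge P (- Q) = - wedge P Q.
Proof. by rewrite -scaleN1r wedgeZr scaleN1r. Qed.

Lemma homog_sum k (I : Type) (r : seq I) (F : I -> altform T) :
  (forall i, homog k (F i)) -> homog k (\sum_(i <- r) F i).
Proof. by move=> HF s sk; rewrite altform_sumE big1 // => i _; exact: HF. Qed.

Lemma homogZ k f P : homog k P -> homog k (f *: P).
Proof. by move=> HP s sk; rewrite -[LHS]/(f * P s) HP // mulr0. Qed.

Lemma homog_cst f : homog 0 (wcst T f).
Proof. by case. Qed.

Lemma homog0P P : homog 0 P -> P = wcst T (P [::]).
Proof. by move=> HP; apply: altform_eq => -[|u s] //=; rewrite HP. Qed.

Lemma wedge1_cons t Q u s : homog 1 t ->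
  wedge t Q (u :: s) = t [:: u] * Q s - wedge t (contr u Q) s.
Proof.
move=> Ht; rewrite -[LHS]/(wedge_fun (wcontr u t) Q s + wedge_fun (winvol t) (wcontr u Q) s).
have -> : wcontr u t = @wcst_fun K T (t [:: u]).
  by apply/funext => -[|v z] //=; exact: Ht.
have -> : winvol t = (fun z => (-1) * t z + 0).
  apply/funext => z; rewrite /winvol addr0.
  by have [/eqP ->|zn] := boolP (size z == 1%N); rewrite ?expr1 // Ht // !mulr0.
by rewrite wedge_fun_cst wedge_fun_linl wedge_fun0l mulN1r addr0.
Qed.

Variables (S : Type) (th : S -> altform T) (chi : K) (r : seq (S * T)).
Hypothesis th1 : forall l, homog 1 (th l).
Hypothesis frame : forall u, chi *: u = \sum_(g <- r) th g.1 [:: u] *: g.2.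

(** Euler's identity: the sum of e^g wedge the contraction by e_g is multiplication by the degree,
    here up to the defect chi. It writes a form of positive degree as a sum of one-forms wedge forms
    of lower degree, which drives the inductions on degree. *)
Lemma frame_euler k P : homog k P ->
  k%:R *: (chi *: P) = \sum_(g <- r) wedge (th g.1) (contr g.2 P).
Proof.
move=> HP; apply: altform_eq => s.
suff {k HP} -> : (\sum_(g <- r) wedge (th g.1) (contr g.2 P)) s = (size s)%:R * (chi * P s).
  rewrite -[LHS]/(k%:R * (chi * P s)).
  by have [->//|sk] := eqVneq (size s) k; rewrite HP // !mulr0.
elim: s P => [|u s IH] P; rewrite altform_sumE.
  rewrite mul0r big1 // => g _.
  by rewrite -[LHS]/(th g.1 [::] * _) th1 // mul0r.
under eq_bigr => g _ do rewrite wedge1_cons //.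
rewrite sumrB -[X in X - _](@altform_lin_sum P [::] s _ r (fun g => th g.1 [:: u]) snd) -frame.
rewrite altformZ [size _]/= mulrS mulrDl mul1r; congr (_ + _).
rewrite -[RHS](IH (contr u P)) altform_sumE -sumrN; apply: eq_bigr => g _.
have -> : contr u (contr g.2 P) = -1 *: contr g.2 (contr u P).
  by apply: altform_eq => z; rewrite -[RHS]/(-1 * P _) mulN1r; exact: altform_swap.
by rewrite wedgeZr -[X in - X]/(-1 * _) mulN1r opprK.
Qed.

(** Pigeonhole: multiply every argument by chi and expand it in the frame; with more arguments than
    frame members, each term repeats one of them. In [key], [idx] lists the members already
    substituted. *)
Lemma frame_degree_bound P s : (size r < size s)%N -> chi ^+ size s * P s = 0.
Proof.
have key t (idx : seq 'I_(size r)) : (size r < size idx + size t)%N ->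
   P ([seq (tnth (in_tuple r) i).2 | i <- idx] ++ [seq chi *: u | u <- t]) = 0.
  elim: t idx => [|u t IH] idx sz /=.
    rewrite cats0; have : ~~ uniq idx.
      apply/negP => /card_uniqP E; move: sz; rewrite addn0 -E ltnNge.
      by rewrite (leq_trans (max_card _)) // card_ord.
    case/not_uniq_split => i [s1 [s2 [s3 ->]]].
    by rewrite map_cat /= map_cat /=; exact: wfun_alt.
  rewrite frame big_tnth altform_lin_sum big1 // => i _.
  have := IH (rcons idx i); rewrite map_rcons cat_rcons => ->; first by rewrite mulr0.
  by rewrite size_rcons addSnnS.
move=> sz; rewrite -[RHS](key s [::]) //= => {sz key}.
have : forall t, P (t ++ [seq chi *: u | u <- s]) = chi ^+ size s * P (t ++ s).
  elim: s => [|u s IH] t; first by rewrite expr0 mul1r.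
  by rewrite /= altformZ -cat_rcons IH exprS mulrA cat_rcons.
by move=> /(_ [::]) ->.
Qed.

End AltAlgebra.

(** * Local frames of the eigenbundles *)

Section Frames.
Variables (R : realType) (n : nat) (M : manifold R n).
Local Notation A := (Cinf M).
Local Notation K := (cplx A).
Local Notation E := (gtan M).
Local Notation pair := (cbil (@pairing R n M)).

Definition rfun (f : A) : K := Cplx f 0.

Lemma cre_sum (V : zmodType) (I : Type) (r : seq I) (F : I -> cplx V) :
  cre (\sum_(i <- r) F i) = \sum_(i <- r) cre (F i).
Proof. by elim: r => [|i r IH]; rewrite ?big_nil // !big_cons -IH. Qed.
Lemma cim_sum (V : zmodType) (I : Type) (r : seq I) (F : I -> cplx V) :
  cim (\sum_(i <- r) F i) = \sum_(i <- r) cim (F i).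
Proof. by elim: r => [|i r IH]; rewrite ?big_nil // !big_cons -IH. Qed.

Lemma gtan_fst_sum (I : Type) (r : seq I) (F : I -> E) :
  (\sum_(i <- r) F i).1 = \sum_(i <- r) (F i).1.
Proof. by elim: r => [|i r IH]; rewrite ?big_nil // !big_cons -IH. Qed.
Lemma gtan_snd_sum (I : Type) (r : seq I) (F : I -> E) :
  (\sum_(i <- r) F i).2 = \sum_(i <- r) (F i).2.
Proof. by elim: r => [|i r IH]; rewrite ?big_nil // !big_cons -IH. Qed.
Lemma oneform_sumE (I : Type) (r : seq I) (F : I -> oneform M) X :
  (\sum_(i <- r) F i) X = \sum_(i <- r) F i X.
Proof. by elim: r => [|i r IH]; rewrite ?big_nil // !big_cons -IH. Qed.
Lemma omf_sum (a : oneform M) (I : Type) (r : seq I) (F : I -> vfield M) :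
  a (\sum_(i <- r) F i) = \sum_(i <- r) a (F i).
Proof. by elim: r => [|i r IH]; rewrite ?big_nil ?omf0 // !big_cons omfD IH. Qed.

Lemma half2 : ccst M 2^-1 * 2%:R = 1.
Proof.
apply: cinf_eq => x; rewrite mulr2n mulrDr mulr1 cinf_addE /=.
have : (2^-1 + 2^-1 : R) = 1 by lra. exact.
Qed.

Lemma pairing2 (u v : E) : 2%:R * pairing u v = u.2 v.1 + v.2 u.1.
Proof. by rewrite /pairing mulrA [2%:R * _]mulrC half2 mul1r. Qed.

Lemma pairingC (u v : E) : pairing u v = pairing v u.
Proof. by rewrite /pairing addrC. Qed.

Lemma pairing0l (v : E) : pairing 0 v = 0.
Proof. by have := pairingZr v 0 0; rewrite scale0r mul0r pairingC. Qed.

Lemma cpairC (u v : cplx E) : pair u v = pair v u.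
Proof. by apply: cplx_eq; rewrite /= ?(pairingC (cre u)) ?(pairingC (cim u)) // addrC. Qed.

Lemma cpairZr (e : cplx E) f u : pair e (f *: u) = f * pair e u.
Proof.
have e0 : pair e 0 = 0.
  have := cpairing_lin e 1 0 0; rewrite scaler0 addr0 mul1r => e0.
  by apply: (addrI (pair e 0)); rewrite addr0 -e0.
by rewrite -[f *: u]addr0 cpairing_lin e0 addr0.
Qed.

Lemma cpairDr (e : cplx E) u v : pair e (u + v) = pair e u + pair e v.
Proof. by rewrite -[u]scale1r cpairing_lin mul1r scale1r. Qed.

(** The frame of T is joined with its transpose chi *: al = sum_g al(g.2) *: d(g.1) on one-forms.
    The coefficients are written as pairings so that they survive projection to the eigenbundles. *)
Lemma gtan_frame (p : M) : exists (chi : A) (s : seq (E * E)),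
  [/\ chi p != 0, size s = (n.+1 + n.+1)%N &
      forall u : E, chi *: u = \sum_(g <- s) (2%:R * pairing g.1 u) *: g.2].
Proof.
have [chi [s [chip sz fr]]] := local_frame p.
exists chi, ([seq ((0, extd g.1) : E, (g.2, 0) : E) | g <- s] ++
  [seq ((g.2, 0) : E, (0, extd g.1) : E) | g <- s]); split=> //.
  by rewrite size_cat !size_map sz.
move=> [X al]; rewrite big_cat !big_map /=.
under eq_bigr => g _ do rewrite pairing2 /= omf0 addr0.
under [X in _ = _ + X]eq_bigr => g _ do rewrite pairing2 /= add0r.
rewrite [LHS]surjective_pairing [RHS]surjective_pairing; congr Datatypes.pair.
  rewrite -[RHS]/((\sum_(g <- s) _).1 + (\sum_(g <- s) _).1) !gtan_fst_sum -[LHS]/(chi *: X).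
  by rewrite fr [X in _ + X]big1 ?addr0 // => g _; exact: scaler0.
rewrite -[RHS]/((\sum_(g <- s) _).2 + (\sum_(g <- s) _).2) !gtan_snd_sum -[LHS]/(chi *: al).
rewrite [X in X + _]big1 ?add0r; last by move=> g _; exact: scaler0.
apply: oneform_eq => Z; rewrite oneform_sumE oneform_scaleE -omfZ fr omf_sum.
by apply: eq_bigr => g _; rewrite oneform_scaleE omfZ mulrC.
Qed.

Lemma cgtan_frame (p : M) : exists (chi : A) (s : seq (cplx E * cplx E)),
  [/\ chi p != 0, size s = (n.+1 + n.+1)%N &
      forall u : cplx E, rfun chi *: u = \sum_(g <- s) (2%:R * pair g.1 u) *: g.2].
Proof.
have [chi [s [chip sz fr]]] := gtan_frame p.
exists chi, [seq (Cplx g.1 0, Cplx g.2 0) | g <- s]; split=> //.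
  by rewrite size_map.
move=> u; rewrite big_map; apply: cplx_eq; rewrite ?cre_sum ?cim_sum /=.
  rewrite scale0r subr0 fr; apply: eq_bigr => g _.
  by rewrite !pairing0l !subr0 !addr0 mul0r subr0 scaler0 subr0.
rewrite scale0r addr0 fr; apply: eq_bigr => g _.
by rewrite !(pairing0l, subr0, addr0, mul0r, scaler0, add0r).
Qed.


Lemma cpairing2 (e u : cplx E) :
  2%:R * pair e u = cbil (fun u v : E => u.2 v.1 + v.2 u.1) e u.
Proof.
rewrite mulr_natl mulr2n; apply: cplx_eq; rewrite /= -!pairing2; ring.
Qed.

Lemma rfun_eq0 (chi : A) (z : K) (p : M) : chi p != 0 -> rfun chi * z = 0 ->
  cre z p = 0 /\ cim z p = 0.
Proof.
move=> chip E0.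
have Er : chi p * cre z p = 0.
  by have := congr1 (fun w : K => cre w p) E0; rewrite /= !fctE /= mul0r subr0.
have Ei : chi p * cim z p = 0.
  by have := congr1 (fun w : K => cim w p) E0; rewrite /= !fctE /= mul0r addr0.
by move: Er Ei => /eqP; rewrite mulf_eq0 (negbTE chip) => /eqP -> /eqP;
  rewrite mulf_eq0 (negbTE chip) => /eqP ->.
Qed.

Lemma rfunM (f g : A) : rfun (f * g) = rfun f * rfun g.
Proof. by apply: cplx_eq => /=; ring. Qed.

Lemma rfun1 : rfun 1 = 1. Proof. by []. Qed.

Lemma cplx_fun_eq (z w : K) :
  (forall p, cre z p = cre w p /\ cim z p = cim w p) -> z = w.
Proof. by move=> H; apply: cplx_eq; apply: cinf_eq => p; have [] := H p. Qed.

Variable J : gcs M.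
Local Notation cJ := (cJ J).

Lemma cJ_lin a u v : cJ (a *: u + v) = a *: cJ u + cJ v.
Proof.
by apply: cplx_eq => /=; [rewrite linearD linearB|rewrite !linearD];
   rewrite -?(linearZZ J).
Qed.

Lemma cJ_sqr e : cJ (cJ e) = - e.
Proof. by apply: cplx_eq; rewrite /= gJ_sqr. Qed.

Lemma cJ_skew e u : pair (cJ e) u = - pair e (cJ u).
Proof. by apply: cplx_eq; rewrite /= !gJ_skew; ring. Qed.

Lemma ci_sqr : ci * ci = -1 :> K.
Proof. by apply: cplx_eq => /=; ring. Qed.

Definition chalf : K := rfun (ccst M 2^-1).

Lemma chalf2 : chalf * 2%:R = 1.
Proof.
rewrite -[RHS]rfun1 -half2 rfunM; congr (_ * _).
by rewrite !mulr2n; apply: cplx_eq; rewrite /= ?addr0.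
Qed.

(** Skewness of J gives c < e, u > = - c < e, u >, and both c and 2 are invertible. The parameter c
    serves both eigenvalues i and - i. *)
Lemma eigen_isotropic (c : K) e u : c * c = -1 -> cJ e = c *: e -> cJ u = c *: u ->
  pair e u = 0.
Proof.
move=> cc He Hu; have := cJ_skew e u; rewrite He Hu cpairC !cpairZr (cpairC u e) => H.
have : chalf * (2%:R * (c * (c * pair e u))) = 0.
  by rewrite [2%:R * _]mulr_natl mulr2n {1}H mulrN addNr mulr0.
by rewrite mulrA chalf2 mul1r mulrA cc mulN1r => /eqP; rewrite oppr_eq0 => /eqP.
Qed.

Lemma inLbarE e : reflect (cJ e = - ci *: e) (e \in inLbar J).
Proof.
apply: (iffP (inLbarP J e)) => [/inLP|] H.
  rewrite -[e]cplx_conjK; move: H; move: (cplx_conj e) => w Hw.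
  have -> : - ci = cplx_conj ci :> K by apply: cplx_eq; rewrite //= oppr0.
  rewrite -cplx_conjZ -Hw; apply: cplx_eq => //=; exact: linearN.
apply/inLP; have -> : ci = cplx_conj (- ci) :> K by apply: cplx_eq; rewrite /= ?oppr0 ?opprK.
rewrite -cplx_conjZ -H; apply: cplx_eq => //=; exact: linearN.
Qed.

(** The spectral projector (1 + J / c) / 2 onto the c-eigenspace, for c with c * c = -1, where 1 / c
    = - c. *)
Definition proj (c : K) (e : cplx E) : cplx E := chalf *: (e - c *: cJ e).

Lemma proj_eigen c e : c * c = -1 -> cJ (proj c e) = c *: proj c e.
Proof.
move=> cc.
have J0 : cJ 0 = 0 by apply: cplx_eq; exact: linear0.
have cJZ a u : cJ (a *: u) = a *: cJ u by rewrite -[a *: u]addr0 cJ_lin J0 addr0.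
rewrite /proj cJZ scalerA [c * _]mulrC -scalerA; congr (_ *: _).
rewrite addrC -scaleNr cJ_lin cJ_sqr scalerDr scalerA mulrN cc opprK scale1r.
by rewrite scaleNr scalerN opprK addrC.
Qed.

Lemma proj_id c e : c * c = -1 -> cJ e = c *: e -> proj c e = e.
Proof.
move=> cc He; rewrite /proj He scalerA cc scaleN1r opprK -mulr2n -scaler_nat.
by rewrite scalerA chalf2 scale1r.
Qed.

Lemma proj_lin c a u v : proj c (a *: u + v) = a *: proj c u + proj c v.
Proof.
rewrite /proj cJ_lin [c *: (_ + _)]scalerDr opprD addrACA scalerDr; congr (_ + _).
by rewrite scalerA [c * a]mulrC -scalerA -scalerBr !scalerA mulrC.
Qed.

Lemma proj_split c e : e = proj c e + proj (- c) e.
Proof.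
rewrite /proj -scalerDr scaleNr opprK addrACA addNr addr0 -mulr2n -scaler_nat.
by rewrite scalerA chalf2 scale1r.
Qed.

Fact projL_in e : proj ci e \in inL J.
Proof. apply/inLP/proj_eigen/ci_sqr. Qed.
Fact projLbar_in e : proj (- ci) e \in inLbar J.
Proof. by apply/inLbarE/proj_eigen; rewrite mulrNN ci_sqr. Qed.
Definition projL e : Lsec J := exist (fun e => e \in inL J) _ (projL_in e).
Definition projLbar e : Lbarsec J := exist (fun e => e \in inLbar J) _ (projLbar_in e).

Lemma L_isotropic (l l' : Lsec J) : pair (val l) (val l') = 0.
Proof. by apply: (eigen_isotropic ci_sqr); apply/inLP; exact: valP. Qed.

Lemma Lbar_isotropic (l l' : Lbarsec J) : pair (val l) (val l') = 0.
Proof.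
by apply: (@eigen_isotropic (- ci)); [rewrite mulrNN ci_sqr|apply/inLbarE; exact: valP..].
Qed.

Lemma val_Lbar_sum (I : Type) (r : seq I) (F : I -> Lbarsec J) :
  val (\sum_(i <- r) F i) = \sum_(i <- r) val (F i).
Proof. by elim: r => [|i r IH]; rewrite ?big_nil // !big_cons -IH. Qed.

(** Project the frame of the whole bundle to Lbar, which fixes u. The dual vectors may be projected
    to L because their Lbar components pair to zero with u by isotropy. *)
Lemma Lbar_frame (p : M) : exists (chi : A) (s : seq (Lsec J * Lbarsec J)),
  [/\ chi p != 0, size s = (n.+1 + n.+1)%N &
      forall u : Lbarsec J,
        rfun chi *: u = \sum_(g <- s) wvec g.1 [:: u] *: g.2].
Proof.
have [chi [s [chip sz fr]]] := cgtan_frame p.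
exists chi, [seq (projL g.1, projLbar g.2) | g <- s]; split=> //.
  by rewrite size_map.
move=> u; apply: val_inj; rewrite val_Lbar_sum big_map /=.
have pu : proj (- ci) (val u) = val u.
  by apply: proj_id; [rewrite mulrNN ci_sqr|apply/inLbarE; exact: valP].
have pS (I : Type) (r : seq I) (c : I -> K) (F : I -> cplx E) :
    proj (- ci) (\sum_(i <- r) c i *: F i) = \sum_(i <- r) c i *: proj (- ci) (F i).
  elim: r => [|i r IH]; last by rewrite !big_cons proj_lin IH.
  rewrite !big_nil; have := proj_lin (- ci) (-1) 0 0; rewrite scaler0 addr0.
  by rewrite scaleN1r addNr.
have p0 : proj (- ci) 0 = 0.
  by have := pS _ [::] (fun i : nat => 0) (fun=> 0); rewrite !big_nil.
have pZ := proj_lin (- ci) (rfun chi) (val u) 0; rewrite p0 !addr0 pu in pZ.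
rewrite -[LHS]/(rfun chi *: val u) -pZ fr pS.
apply: eq_bigr => g _; congr (_ * _ *: _).
rewrite {1}(proj_split ci g.1) cpairC cpairDr.
by rewrite [X in _ + X](Lbar_isotropic u (projLbar g.1)) addr0 cpairC.
Qed.

Lemma homog_wvec (l : Lsec J) : homog 1 (wvec l).
Proof. by case=> [|u [|v s]]. Qed.

Lemma wvec_lin_sum (I : Type) (r : seq I) (c : I -> K) (F : I -> Lsec J) :
  wvec (\sum_(i <- r) c i *: F i) = \sum_(i <- r) c i *: wvec (F i).
Proof.
elim: r => [|i r IH]; rewrite ?big_nil ?big_cons -?IH; apply: altform_eq => -[|u [|v s]] //=.
- by rewrite cpairC; have := cpairZr (val u) 0 0; rewrite scale0r mul0r => ->; rewrite mulr0.
- by rewrite mulr0 addr0.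
- rewrite cpairC cpairDr cpairZr -!(cpairC _ (val u)) mulrDr mulrCA //.
- by rewrite mulr0 addr0.
Qed.

Lemma vf0E (X : vfield M) : X 0 = 0.
Proof. by apply: (addrI (X 0)); rewrite -vfD !addr0. Qed.

Lemma null_anchor (e : cplx E) : (forall f, anchor e f = 0) ->
  (cre e).1 = 0 /\ (cim e).1 = 0.
Proof.
move=> H; split; apply: vfield_eq => f.
  by have := congr1 (@cre _) (H (rfun f)); rewrite /= vf0E subr0.
by have := congr1 (@cim _) (H (rfun f)); rewrite /= vf0E add0r.
Qed.

(* A vanishing anchor means that l lies in T^*; locally chi l = sum_g g.2 d(g.1). *)
Lemma null_anchor_frame (l : cplx E) (p : M) : (forall f, anchor l f = 0) ->
  exists (chi : A) (s : seq (A * K)), chi p != 0 /\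
    forall e : cplx E, \sum_(g <- s) g.2 * anchor e (rfun g.1) =
      rfun chi * (2%:R * pair l e).
Proof.
move=> /null_anchor[l1 l2]; have [chi [s [chip _ fr]]] := local_frame p.
exists chi, [seq (g.1, Cplx ((cre l).2 g.2) ((cim l).2 g.2)) | g <- s]; split=> //.
move=> e; rewrite big_map cpairing2.
have E1 (al : oneform M) (X : vfield M) : chi * al X = \sum_(g <- s) X g.1 * al g.2.
  by rewrite -omfZ fr omf_sum; apply: eq_bigr => g _; rewrite omfZ.
apply: cplx_eq; rewrite ?cre_sum ?cim_sum /= l1 l2 !omf0 !addr0 mul0r ?subr0 ?addr0.
  rewrite mulrBr !E1 -sumrB; apply: eq_bigr => g _.
  by rewrite !vf0E; ring.
rewrite mulrDr !E1 -big_split /=; apply: eq_bigr => g _.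
by rewrite !vf0E; ring.
Qed.

End Frames.

(** * Nilpotency of phi *)

Section Nilpotent.
Variables (R : realType) (n : nat) (M : manifold R n) (J : gcs M).
Local Notation A := (Cinf M).
Local Notation K := (cplx A).
Local Notation W := (wedgeL J).
Local Notation "P ^^ Q" := (wedge P Q : W) (at level 40, left associativity).
Implicit Types (P Q : W) (F : W -> W) (f : K).

(** The passage from frames with a defect chi to global identities: chi may depend on the point. *)
Lemma wedgeL_local0 P :
  (forall p, exists chi : A, chi p != 0 /\ rfun chi *: P = 0) -> P = 0.
Proof.
move=> H; apply: altform_eq => s; apply: cplx_fun_eq => p.
have [chi [chip E0]] := H p; apply: rfun_eq0 chip _.
exact: (congr1 (fun Q : W => Q s) E0).
Qed.

Lemma RconstE r : Rconst M r = rfun (ccst M r).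
Proof. by []. Qed.
Lemma RconstM r s : Rconst M (r * s) = Rconst M r * Rconst M s.
Proof. by rewrite !RconstE -rfunM; congr rfun; apply: cinf_eq. Qed.
Lemma Rconst0 : Rconst M 0 = 0.
Proof. by apply: cplx_eq; apply: cinf_eq. Qed.
Lemma Rconst1 : Rconst M 1 = 1.
Proof. by apply: cplx_eq; apply: cinf_eq. Qed.
Lemma RconstD r s : Rconst M (r + s) = Rconst M r + Rconst M s.
Proof. by apply: cplx_eq; apply: cinf_eq => x //=; rewrite addr0. Qed.
Lemma Rconst_nat k : Rconst M k%:R = k%:R.
Proof. by elim: k => [|k IH]; rewrite ?Rconst0 // !mulrS RconstD IH Rconst1. Qed.

Lemma mulrn_inj k P Q : P *+ k.+1 = Q *+ k.+1 -> P = Q.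
Proof.
rewrite -!scaler_nat -!Rconst_nat => E.
have k0 : k.+1%:R != 0 :> R by rewrite pnatr_eq0.
rewrite -[P]scale1r -[Q]scale1r -Rconst1 -(mulVf k0) RconstM -!scalerA.
by rewrite E.
Qed.

Section ClinearTheory.
Variable F : W -> W.
Hypothesis linF : Clinear F.

Lemma ClinD P Q : F (P + Q) = F P + F Q.
Proof. by have := linF 1 P Q; rewrite -[Cconst M 1]/(Rconst M 1) Rconst1 !scale1r. Qed.
Lemma Clin0 : F 0 = 0.
Proof. by apply: (addrI (F 0)); rewrite -ClinD !addr0. Qed.
Lemma ClinN P : F (- P) = - F P.
Proof. by apply: (addrI (F P)); rewrite -ClinD !addrN Clin0. Qed.
Lemma ClinR r P : F (Rconst M r *: P) = Rconst M r *: F P.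
Proof. by rewrite -[Rconst M r *: P]addr0 linF Clin0 addr0. Qed.
Lemma Clin_sum (I : Type) (r : seq I) (E : I -> W) :
  F (\sum_(i <- r) E i) = \sum_(i <- r) F (E i).
Proof. by elim: r => [|i r IH]; rewrite ?big_nil ?Clin0 // !big_cons ClinD IH. Qed.
Lemma ClinMn P k : F (P *+ k) = F P *+ k.
Proof. by elim: k => [|k IH]; rewrite ?mulr0n ?Clin0 // !mulrS ClinD IH. Qed.

End ClinearTheory.

Variables (br : W -> W -> W) (dbar : W -> W) (G1 : W)
  (phi0 : {linear Lsec J -> Lsec J}) (phi : W -> W).
Hypotheses (Hbr : is_schouten br) (Hdbar : is_dbar dbar)
  (Hcp : compatible_pair br dbar G1 phi0 phi).
Let Hext := cp_ext Hcp.
Let phi_lin := ext_lin Hext.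

Lemma phiZ f P : phi (f *: P) = f *: phi P.
Proof.
rewrite -wedge_cst (cp_wedge Hcp) (ext_fun Hext) wedge0l add0r.
exact: wedge_cst.
Qed.

Lemma br_fun_vec f (l : Lsec J) : br (wcst _ f) (wvec l) = - wcst _ (anchor (val l) f).
Proof.
rewrite (sch_skew Hbr (homog_cst f) (@homog_wvec _ _ _ _ l)) (sch_anchor Hbr).
by rewrite mul1n sqrrN expr1n scale1r.
Qed.

(** The Leibniz correction is the bracket of two functions, which would have degree - 1 and so
    vanishes. *)
Lemma br_funZ f g P : br (wcst _ f) (g *: P) = g *: br (wcst _ f) P.
Proof.
rewrite -wedge_cst (sch_leibniz Hbr _ (homog_cst f) (homog_cst g)) muln0 expr0 scale1r.
have -> : br (wcst _ f) (wcst _ g) = 0.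
  apply: altform_eq => s; apply: (sch_homog Hbr (homog_cst f) (homog_cst g)).
  by rewrite addn0.
by rewrite wedge0l add0r wedge_cst.
Qed.

Lemma br_fun_wedge f (l q : Lsec J) : br (wcst _ f) (wvec l ^^ wvec q) =
  anchor (val q) f *: wvec l - anchor (val l) f *: wvec q.
Proof.
rewrite (sch_leibniz Hbr _ (homog_cst f) (@homog_wvec _ _ _ _ l)) !br_fun_vec.
by rewrite expr1 scaleN1r wedgeNl wedgeNr opprK wedge_cst wedge_cstr addrC.
Qed.

Lemma br_2fun f P : homog 2 P -> br P (wcst _ f) = br (wcst _ f) P.
Proof.
move=> HP; rewrite (sch_skew Hbr HP (homog_cst f)) muln1.
by rewrite -signr_odd expr1 scaleN1r opprK.
Qed.

(* phi kills L /\ T^*: such a section is locally a combination of elements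
   dbar y, and phi (dbar y) = - [G1, y], which only involves the values of the
   section on rho(L), zero because L is isotropic. *)
Lemma phi_null (l : Lsec J) : (forall f, anchor (val l) f = 0) -> phi (wvec l) = 0.
Proof.
move=> l0; apply: wedgeL_local0 => p.
have [c1 [s1 [c1p fr1]]] := null_anchor_frame p l0.
have [c2 [s2 [c2p _ fr2]]] := Lbar_frame J p.
exists (c2 * c2 * c1); split; first by rewrite !cinf_mulE !mulf_neq0.
have E1 : rfun c1 *: wvec l = \sum_(g <- s1) g.2 *: dbar (wcst _ (rfun g.1)).
  apply: altform_eq => s; rewrite altform_sumE -[LHS]/(rfun c1 * wvec l s).
  have [s0|sn] := eqVneq (size s) 1%N; last first.
    rewrite homog_wvec // mulr0 big1 // => g _.
    rewrite -[LHS]/(g.2 * _) (dbar_homog Hdbar (homog_cst _)) ?mulr0 //.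
  case: s s0 => [|u [|]] // _; rewrite -[wvec l _]/(2%:R * _) -fr1.
  by apply: eq_bigr => g _; rewrite -[RHS]/(g.2 * _) (dbar_fun Hdbar).
(* Condition (i) on a function, which phi kills. *)
have E2 f : phi (dbar (wcst _ f)) = - br (wcst _ f) G1.
  rewrite -(br_2fun _ (cp_homog Hcp)) -(cp_dbar Hcp) (ext_fun Hext).
  by rewrite (Clin0 (dbar_lin Hdbar)) sub0r opprK.
(* The section of L that represents [c2] times the contraction of [G1] by [g.2]. *)
pose q (g : Lsec J * Lbarsec J) : Lsec J :=
  \sum_(h <- s2) contr g.2 G1 [:: h.2] *: h.1.
have E3 g : rfun c2 *: contr g.2 G1 = wvec (q g).
  rewrite wvec_lin_sum; apply: altform_eq => s; rewrite altform_sumE.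
  rewrite -[LHS]/(rfun c2 * contr g.2 G1 s).
  have [s0|sn] := eqVneq (size s) 1%N; last first.
    rewrite (homog_contr g.2 (cp_homog Hcp)) // mulr0 big1 // => h _.
    by rewrite -[LHS]/(_ * wvec h.1 s) homog_wvec // mulr0.
  case: s s0 => [|u [|]] // _.
  rewrite -(altformZ (contr g.2 G1) [::] [::]) fr2.
  rewrite (altform_lin_sum (contr g.2 G1) [::] [::]); apply: eq_bigr => h _.
  by rewrite -[RHS]/(_ * wvec h.1 [:: u]) mulrC.
(* One factor [c2] comes from Euler's identity and the other from representing the contractions by
   sections of L; the 2 is the degree of [G1]. *)
have E4 : 2%:R *: (rfun (c2 * c2) *: G1) = \sum_(g <- s2) wvec g.1 ^^ wvec (q g).
  rewrite rfunM -scalerA scalerA mulrC -scalerA.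
  rewrite (frame_euler (@homog_wvec _ _ _ J) fr2 (cp_homog Hcp)) scaler_sumr.
  by apply: eq_bigr => g _; rewrite -wedgeZr E3.
have E5 : 2%:R *: (rfun (c2 * c2 * c1) *: phi (wvec l)) = 0.
  rewrite rfunM -scalerA -phiZ E1 (Clin_sum phi_lin).
  under eq_bigr => g _ do rewrite phiZ E2.
  rewrite scalerA scaler_sumr.
  transitivity (- \sum_(g <- s1) g.2 *: br (wcst _ (rfun g.1))
    (2%:R *: (rfun (c2 * c2) *: G1))).
    rewrite -sumrN; apply: eq_bigr => g _.
    by rewrite !br_funZ !scalerN !scalerA; congr (- (_ *: _)); ring.
  rewrite E4; apply/eqP; rewrite oppr_eq0; apply/eqP.
  under eq_bigr => g _ do rewrite (Clin_sum (sch_linr Hbr _)) scaler_sumr.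
  rewrite exchange_big big1 // => h _ /=.
  under eq_bigr => g _ do rewrite br_fun_wedge scalerBr !scalerA.
  (* Summing over [s1] first, each coefficient becomes [c1] times the pairing of l with a section of
     L, which vanishes. *)
  rewrite sumrB -!scaler_suml !fr1 !L_isotropic !mulr0 !scale0r subr0 //.
rewrite -[LHS]scale1r -(@chalf2 R n M) -scalerA E5 scaler0 //.
Qed.

Lemma phi_sq (l : Lsec J) : phi (phi (wvec l)) = 0.
Proof.
rewrite (ext_vec Hext); apply: phi_null => f.
have := cp_br Hcp (wvec l) (wcst _ f).
rewrite (ext_fun Hext) (ext_vec Hext) !(sch_anchor Hbr) (ext_fun Hext).
rewrite (Clin0 (sch_linr Hbr _)) addr0 => E.
exact: (congr1 (fun Q : W => Q [::]) E).
Qed.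

Lemma iter_phi_lin k f P Q : iter k phi (f *: P + Q) = f *: iter k phi P + iter k phi Q.
Proof. by elim: k => //= k ->; rewrite (ClinD phi_lin) phiZ. Qed.
Lemma iter_phi0 k : iter k phi 0 = 0.
Proof. by elim: k => //= k ->; exact: Clin0 phi_lin. Qed.
Lemma iter_phiZ k f P : iter k phi (f *: P) = f *: iter k phi P.
Proof. by rewrite -[f *: P]addr0 iter_phi_lin iter_phi0 addr0. Qed.
Lemma iter_phiD k P Q : iter k phi (P + Q) = iter k phi P + iter k phi Q.
Proof. by rewrite -[P]scale1r iter_phi_lin !scale1r. Qed.
Lemma iter_phi_sum k (I : Type) (r : seq I) (E : I -> W) :
  iter k phi (\sum_(i <- r) E i) = \sum_(i <- r) iter k phi (E i).
Proof. by elim: r => [|i r IH]; rewrite ?big_nil ?iter_phi0 // !big_cons iter_phiD IH. Qed.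

(** The binomial formula for a derivation, cut down to two terms by [phi_sq]. *)
Lemma iter_phi_wedge k (l : Lsec J) P : iter k.+1 phi (wvec l ^^ P) =
  wvec l ^^ iter k.+1 phi P + (phi (wvec l) ^^ iter k phi P) *+ k.+1.
Proof.
elim: k => [|k IH]; first by rewrite /= (cp_wedge Hcp) addrC.
rewrite iterS IH (ClinD phi_lin) (ClinMn phi_lin) !(cp_wedge Hcp) phi_sq wedge0l add0r.
by rewrite -!iterS addrAC -mulrS addrC.
Qed.

(** Induction on the degree through [frame_euler]: the contractions have one degree less, so one
    application of phi fewer kills them, and both terms of [iter_phi_wedge] vanish. The positive
    degree k + 1 can be divided out. *)
Lemma phi_nil_homog k P : homog k P -> iter k.+1 phi P = 0.
Proof.
elim: k P => [|k IH] P HP; first by rewrite /= (homog0P HP) (ext_fun Hext).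
apply: wedgeL_local0 => p; have [chi [s [chip _ fr]]] := Lbar_frame J p.
exists chi; split=> //.
have E : (rfun chi *: iter k.+2 phi P) *+ k.+1 = 0 *+ k.+1.
  rewrite mul0rn -scaler_nat -!iter_phiZ (frame_euler (@homog_wvec _ _ _ J) fr HP).
  rewrite iter_phi_sum big1 // => g _.
  have HQ := homog_contr g.2 HP; rewrite iter_phi_wedge iterS (IH _ HQ).
  by rewrite (Clin0 phi_lin) !wedge0r mul0rn addr0.
exact: mulrn_inj E.
Qed.

Lemma iter_homog k d P : homog d P -> homog d (iter k phi P).
Proof. by move=> HP; elim: k => //= k; exact: (ext_homog Hext). Qed.

Lemma degree_bound P s : (n.+1 + n.+1 < size s)%N -> P s = 0.
Proof.
move=> sz; apply: cplx_fun_eq => p; have [chi [r [chip sr fr]]] := Lbar_frame J p.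
have := frame_degree_bound fr P (s := s); rewrite sr => /(_ sz) E.
have rX k : rfun chi ^+ k = rfun (chi ^+ k).
  by elim: k => [|k IH]; rewrite ?expr0 ?rfun1 // !exprS IH rfunM.
have Xp k : (chi ^+ k) p != 0.
  elim: k => [|k IH]; first by rewrite expr0 cinf_1E oner_neq0.
  by rewrite exprS cinf_mulE mulf_neq0.
by apply: rfun_eq0 (Xp (size s)) _; rewrite -rX.
Qed.

Definition wcomp_fun k P (s : seq (Lbarsec J)) : K := if size s == k then P s else 0.
Fact wcomp_lin k P : wlin (wcomp_fun k P).
Proof.
move=> s1 s2 f u v; rewrite /wcomp_fun !size_cat /=.
by case: ifP => _; [exact: wfun_lin|rewrite mulr0 addr0].
Qed.
Fact wcomp_alt k P : walt (wcomp_fun k P).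
Proof. by move=> s1 s2 s3 u; rewrite /wcomp_fun; case: ifP => // _; exact: wfun_alt. Qed.
Definition wcomp k P : W := MkAltform (wcomp_lin k P) (wcomp_alt k P).

(** Local frames of Lbar have 2n + 2 members at every point, so a section is a finite sum of
    components of degree at most 2n + 2, each killed by the power 2n + 3 of phi. *)
Lemma phi_nilpotent : exists N, forall k P, (N <= k)%N -> iter k phi P = 0.
Proof.
exists (n.+1 + n.+1).+1 => k P Nk.
have -> : P = \sum_(0 <= d < (n.+1 + n.+1).+1) wcomp d P.
  apply: altform_eq => s; rewrite altform_sumE.
  have [sz|sz] := ltnP (n.+1 + n.+1) (size s).
    rewrite degree_bound // big_nat big1 // => d /andP[_ dn].
    by rewrite /= /wcomp_fun; case: eqP dn sz => // <-; rewrite ltnS leqNgt => /negbTE ->.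
  rewrite big_mkord (bigD1 (Ordinal (sz : size s < (n.+1 + n.+1).+1)%N)) //=.
  rewrite /wcomp_fun eqxx big1 ?addr0 // => d /negP dn.
  by case: eqP => // E; case: dn; apply/eqP/val_inj.
rewrite iter_phi_sum big_nat big1 // => d /andP[_ dn].
have Hd : homog d (wcomp d P) by move=> s /negbTE sd; rewrite /= /wcomp_fun sd.
by rewrite -(subnK (leq_trans dn Nk)) iterD phi_nil_homog ?iter_phi0.
Qed.

End Nilpotent.

(** * The exponential of phi *)

Section Convolution.
Variable V : zmodType.
Implicit Types X Y Z : nat -> nat -> V.

(** The product rule on coefficients: in total order k + 1 the factor k + 1 splits as i + (k + 1 -
    i), one summand for differentiating each factor. *)
Lemma antidiagonal_recur X Y Z k :
  (forall i j, X i.+1 j *+ i.+1 = Y i j) -> (forall i j, X i j.+1 *+ j.+1 = Z i j) ->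
  (\sum_(i < k.+2) X i (k.+1 - i)%N) *+ k.+1 =
  \sum_(i < k.+1) (Y i (k - i)%N + Z i (k - i)%N).
Proof.
move=> HY HZ; rewrite -sumrMnl.
have -> : \sum_(i < k.+2) X i (k.+1 - i)%N *+ k.+1 =
  \sum_(i < k.+2) X i (k.+1 - i)%N *+ i + \sum_(i < k.+2) X i (k.+1 - i)%N *+ (k.+1 - i).
  rewrite -big_split; apply: eq_bigr => i _ /=.
  by rewrite -mulrnDr subnKC // -ltnS.
rewrite big_split big_ord_recl mulr0n add0r; congr (_ + _).
  by apply: eq_bigr => i _; rewrite lift0 subSS HY.
rewrite big_ord_recr /= subnn mulr0n addr0; apply: eq_bigr => i _.
by rewrite -HZ subSn // -ltnS.
Qed.

(** Nonzero terms have i and j below N, hence i + j below N + N: cutting all sums at N + N loses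
    nothing on either side. *)
Lemma cauchy_product N X :
  (forall i j, (N <= i)%N || (N <= j)%N -> X i j = 0) ->
  \sum_(k < N + N) \sum_(i < k.+1) X i (k - i)%N =
  \sum_(i < N + N) \sum_(j < N + N) X i j.
Proof.
move=> X0; set m := (N + N)%N.
transitivity (\sum_(k < m) \sum_(i < m | (i <= k)%N) X i (k - i)%N).
  apply: eq_bigr => k _; rewrite (big_ord_widen_cond m predT (fun i => X i (k - i)%N)) //.
rewrite (exchange_big_dep predT) //=; apply: eq_bigr => i _.
have im := ltnW (ltn_ord i).
transitivity (\sum_(j < (m - i)%N) X i j).
  rewrite -(big_mkord (fun k => (i <= k)%N) (fun k => X i (k - i)%N)).
  rewrite (big_cat_nat _ im) //= big_nat_cond big1 ?add0r; last first.
    by move=> k /andP[/andP[_ ki]]; rewrite leqNgt ki.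
  rewrite -{1}[nat_of_ord i]add0n big_addn -(big_mkord predT (X i)).
  by apply: eq_big => k; [rewrite leq_addl|rewrite addnK].
rewrite (big_ord_widen_cond m predT (X i) (leq_subr i m)).
rewrite [RHS](bigID (fun j : 'I_m => (j < m - i)%N)) /=.
rewrite [X in _ + X]big1 ?addr0 // => j; rewrite -leqNgt leq_subLR => ij; apply: X0.
by case: leqP => //= iN; rewrite -(leq_add2l i) (leq_trans _ ij) // /m leq_add2r ltnW.
Qed.

End Convolution.

Section Exponential.
Variables (R : realType) (n : nat) (M : manifold R n) (J : gcs M).
Local Notation W := (wedgeL J).
Local Notation "P ^^ Q" := (wedge P Q : W) (at level 40, left associativity).
Local Notation Rc := (Rconst M).
Variables (br : W -> W -> W) (dbar : W -> W) (G1 : W)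
  (phi0 : {linear Lsec J -> Lsec J}) (phi : W -> W).
Hypotheses (Hbr : is_schouten br) (Hdbar : is_dbar dbar)
  (Hcp : compatible_pair br dbar G1 phi0 phi).
Variables (N : nat).
Hypothesis nilp : forall k P, (N <= k)%N -> iter k phi P = 0.
Implicit Types (P Q : W) (t : R) (i j k : nat).

Let phi_lin := ext_lin (cp_ext Hcp).

Definition dpow t k P : W := Rc (k`!%:R^-1 * t ^+ k) *: iter k phi P.

Lemma dpow0 t P : dpow t 0 P = P.
Proof. by rewrite /dpow fact0 invr1 mul1r expr0 Rconst1 scale1r. Qed.

Let fact_recur t k :
  (k.+1`!%:R^-1 * t ^+ k.+1) * k.+1%:R = t * (k`!%:R^-1 * t ^+ k) :> R.
Proof.
rewrite factS natrM invfM exprS.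
have k0 : k.+1%:R != 0 :> R by rewrite pnatr_eq0.
transitivity (k.+1%:R / k.+1%:R * (t * (k`!%:R^-1 * t ^+ k)) : R).
  by move: (k.+1%:R) (k.+1%:R^-1) (k`!%:R^-1) => x y z; ring.
by rewrite divff // mul1r.
Qed.

(** The equation d/dt exp (t phi) = phi exp (t phi), multiplied by t and read off in order k + 1. *)
Lemma dpowS t k P : dpow t k.+1 P *+ k.+1 = Rc t *: phi (dpow t k P).
Proof.
rewrite -scaler_nat -Rconst_nat /dpow iterS scalerA -RconstM mulrC fact_recur.
by rewrite RconstM -scalerA (phiZ Hcp).
Qed.

Lemma dpowSr t k P : dpow t k.+1 P *+ k.+1 = Rc t *: dpow t k (phi P).
Proof. by rewrite dpowS /dpow (phiZ Hcp) -iterS iterSr. Qed.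

Lemma dpow_eq0 t k P : (N <= k)%N -> dpow t k P = 0.
Proof. by move=> Nk; rewrite /dpow nilp // scaler0. Qed.

Lemma dpow_lin t k f P Q : dpow t k (f *: P + Q) = f *: dpow t k P + dpow t k Q.
Proof. by rewrite /dpow (iter_phi_lin Hcp) scalerDr !scalerA mulrC. Qed.

Lemma dpowD t k P Q : dpow t k (P + Q) = dpow t k P + dpow t k Q.
Proof. by rewrite -[P]scale1r dpow_lin !scale1r. Qed.

Lemma dpow00 t k : dpow t k 0 = 0.
Proof. by rewrite /dpow (iter_phi0 Hcp) scaler0. Qed.

Lemma dpowZ t k f P : dpow t k (f *: P) = f *: dpow t k P.
Proof. by rewrite -[f *: P]addr0 dpow_lin dpow00 addr0. Qed.

Lemma dpow_sum t k m (F : 'I_m -> W) :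
  dpow t k (\sum_i F i) = \sum_i dpow t k (F i).
Proof. by apply: big_morph => [P Q|]; [exact: dpowD|exact: dpow00]. Qed.

(* One more than the nilpotency order, so that gam below vanishes too. *)
Local Notation m := (N.+1 + N.+1)%N.

Definition Phi t P : W := \sum_(k < m) dpow t k P.

Lemma Phi_lin t f P Q : Phi t (f *: P + Q) = f *: Phi t P + Phi t Q.
Proof. by rewrite scaler_sumr -big_split; apply: eq_bigr => k _; exact: dpow_lin. Qed.

Section Bilinear.
Variable B : W -> W -> W.
Hypotheses (Bl : forall Q, Clinear (B^~ Q)) (Br : forall P, Clinear (B P))
  (Bder : forall P Q, B (phi P) Q + B P (phi Q) = phi (B P Q)).

(** Both sides agree in order 0 and satisfy the same recursion once multiplied by k + 1; the
    derivation property of phi on [B] matches the two. *)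
Lemma dpow_bilinear t k P Q :
  dpow t k (B P Q) = \sum_(i < k.+1) B (dpow t i P) (dpow t (k - i) Q).
Proof.
elim: k => [|k IH]; first by rewrite big_ord1 !dpow0.
apply: (@mulrn_inj _ _ _ _ k).
rewrite (antidiagonal_recur (X := fun i j => B (dpow t i P) (dpow t j Q))
  (Y := fun i j => Rc t *: B (phi (dpow t i P)) (dpow t j Q))
  (Z := fun i j => Rc t *: B (dpow t i P) (phi (dpow t j Q)))) => [|i j|i j].
- rewrite dpowS IH (Clin_sum phi_lin) scaler_sumr; apply: eq_bigr => i _.
  by rewrite -scalerDr Bder.
- by rewrite -(ClinMn (Bl _)) dpowS (ClinR (Bl _)).
- by rewrite -(ClinMn (Br _)) dpowS (ClinR (Br _)).
Qed.

Lemma Phi_bilinear t P Q : Phi t (B P Q) = B (Phi t P) (Phi t Q).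
Proof.
rewrite /Phi; under eq_bigr => k _ do rewrite dpow_bilinear.
rewrite (cauchy_product (X := fun i j => B (dpow t i P) (dpow t j Q))) => [|i j].
  rewrite (Clin_sum (Bl _)); apply: eq_bigr => i _.
  by rewrite (Clin_sum (Br _)).
case/orP => /ltnW h; first by rewrite (dpow_eq0 _ _ h) (Clin0 (Bl _)).
by rewrite [X in B _ X](dpow_eq0 _ _ h) (Clin0 (Br _)).
Qed.

End Bilinear.

(** * Coefficients of the deformation and the Maurer-Cartan equation *)

Definition gam t k : W :=
  if k is j.+1 then Rc ((-1) ^+ j * (j.+1)`!%:R^-1 * t ^+ j.+1) *: iter j phi G1 else 0.

(** The term of order k in G1 - phi G, that is, in the derivative of G. With [gam] indexed by the
    power of t, [G1] enters only in order 0. *)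
Definition del t k : W := (if k is 0 then G1 else 0) - phi (gam t k).

Lemma gamS t k : gam t k.+1 *+ k.+1 = Rc t *: del t k.
Proof.
rewrite -scaler_nat -Rconst_nat /del; case: k => [|k].
  by rewrite /= (Clin0 phi_lin) subr0 scalerA -RconstM factS fact0 muln1 invr1 !mul1r expr1.
have N1 : -1 = Rc (-1) :> cplx (Cinf M).
  by apply: (addrI 1); rewrite subrr -Rconst1 -RconstD subrr Rconst0.
rewrite sub0r /gam (phiZ Hcp) -iterS -[X in _ = _ *: X]scaleN1r.
rewrite !scalerA N1 -!RconstM; congr (Rc _ *: _).
transitivity ((-1) ^+ k.+1 * (k.+2`!%:R^-1 * t ^+ k.+2 * k.+2%:R)); first by ring.
by rewrite fact_recur exprS; ring.
Qed.

Lemma gam_eq0 t k : (N.+1 <= k)%N -> gam t k = 0.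
Proof. by case: k => // k Nk; rewrite /gam nilp // scaler0. Qed.

Lemma homog_gam t k : homog 2 (gam t k).
Proof. case: k => [|k] //=; apply: homogZ; exact: (iter_homog Hcp _ (cp_homog Hcp)). Qed.

Definition Gam t : W := \sum_(k < m) gam t k.

Lemma br_sym P Q : homog 2 P -> homog 2 Q -> br P Q = br Q P.
Proof.
move=> HP HQ; rewrite (sch_skew Hbr HP HQ) -signr_odd expr1 scaleN1r opprK //.
Qed.

Lemma dbar_del t k : dbar (del t k) = - phi (dbar (gam t k)) - br G1 (gam t k).
Proof.
rewrite /del (ClinD (dbar_lin Hdbar)) (ClinN (dbar_lin Hdbar)) -(cp_dbar Hcp).
have -> : dbar (if k is 0 then G1 else 0) = 0.
  by case: k => [|k]; [exact: cp_closed Hcp|exact: Clin0 (dbar_lin Hdbar)].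
by rewrite sub0r opprB addKr.
Qed.

(** The term of order k of E = 2 dbar G + [G, G]. By conditions (i) and (ii), E' = - phi E, so each
    order is determined by the previous one, starting from zero. *)
Lemma maurer_cartan_coef t k :
  dbar (gam t k) *+ 2 + \sum_(i < k.+1) br (gam t i) (gam t (k - i)) = 0.
Proof.
elim: k => [|k IH].
  rewrite big_ord1 (Clin0 (dbar_lin Hdbar)) mul0rn add0r.
  exact: Clin0 (sch_linl Hbr _).
apply: (@mulrn_inj _ _ _ _ k); rewrite mul0rn mulrnDl.
rewrite (antidiagonal_recur (X := fun i j => br (gam t i) (gam t j))
  (Y := fun i j => Rc t *: br (del t i) (gam t j))
  (Z := fun i j => Rc t *: br (gam t i) (del t j))) => [|i j|i j]; first last.
- by rewrite -(ClinMn (sch_linr Hbr _)) gamS (ClinR (sch_linr Hbr _)).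
- by rewrite -(ClinMn (sch_linl Hbr _)) gamS (ClinR (sch_linl Hbr _)).
rewrite -mulrnA mulnC mulrnA -(ClinMn (dbar_lin Hdbar)) gamS (ClinR (dbar_lin Hdbar)).
under eq_bigr => i _ do rewrite -scalerDr.
rewrite -scaler_sumr scalerMnr -scalerDr dbar_del.
set S := \sum_(i < _) _.
(* In order k: [G', G] + [G, G'] = 2 [G1, G] - phi [G, G], where condition (ii) collects the terms
   with phi. *)
have -> : S = br G1 (gam t k) *+ 2 - phi (\sum_(i < k.+1) br (gam t i) (gam t (k - i))).
  rewrite (Clin_sum phi_lin) /S.
  have E i : br (del t i) (gam t (k - i)) + br (gam t i) (del t (k - i)) =
     (br (if i is 0 then G1 else 0) (gam t (k - i)) +
      br (gam t i) (if (k - i)%N is 0 then G1 else 0)) - phi (br (gam t i) (gam t (k - i))).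
    rewrite /del (ClinD (sch_linl Hbr _)) (ClinD (sch_linr Hbr _)).
    rewrite (ClinN (sch_linl Hbr _)) (ClinN (sch_linr Hbr _)) -(cp_br Hcp) opprD.
    by rewrite addrACA.
  under eq_bigr => i _ do rewrite E.
  (* Since [G1] sits in order 0, only i = 0 in one sum and i = k in the other contribute; the two
     are equal because the bracket is symmetric in degree 2. *)
  rewrite sumrB; congr (_ - _); rewrite big_split /= mulr2n; congr (_ + _).
    rewrite big_ord_recl big1 ?addr0 ?subn0 // => i _.
    exact: Clin0 (sch_linl Hbr _).
  rewrite big_ord_recr big1 ?add0r /= ?subnn => [|i _].
    by rewrite add0r (br_sym (homog_gam t k) (cp_homog Hcp)).
  case E': (k - i)%N => [|l]; last exact: Clin0 (sch_linr Hbr _).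
  by have := ltn_ord i; rewrite -subn_gt0 E'.
rewrite mulrnBl addrA -[X in X - phi _]addrA addNr addr0 mulNrn.
rewrite -(ClinMn phi_lin) -opprD -(ClinD phi_lin) IH (Clin0 phi_lin) oppr0 scaler0.
by [].
Qed.

Lemma maurer_cartan t : dbar (Gam t) + Rc 2^-1 *: br (Gam t) (Gam t) = 0.
Proof.
apply: (@mulrn_inj _ _ _ _ 1); rewrite mul0rn mulrnDl.
rewrite -[X in _ + X]scaler_nat -Rconst_nat scalerA -RconstM.
rewrite divff ?pnatr_eq0 // Rconst1 scale1r.
rewrite /Gam (Clin_sum (dbar_lin Hdbar)) (Clin_sum (sch_linl Hbr _)).
under [X in _ + X]eq_bigr => i _ do rewrite (Clin_sum (sch_linr Hbr _)).
rewrite -(cauchy_product (X := fun i j => br (gam t i) (gam t j))) => [|i j]; last first.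
  case/orP => h; first by rewrite (gam_eq0 _ h) (Clin0 (sch_linl Hbr _)).
  by rewrite [X in br _ X](gam_eq0 _ h) (Clin0 (sch_linr Hbr _)).
by rewrite -sumrMnl -big_split big1 // => k _; exact: maurer_cartan_coef.
Qed.

(* The coefficients in t of exp (- t phi) dbar exp (t phi). *)
Definition dconj t k P : W := if k is 0 then dbar P else br (gam t k) P.

(** Differentiating a conjugate produces the commutator with phi: for k = 0 it is condition (i), for
    larger k condition (ii) moves phi onto the coefficient of G. *)
Lemma dconjS t k P :
  dconj t k.+1 P *+ k.+1 = Rc t *: (dconj t k (phi P) - phi (dconj t k P)).
Proof.
rewrite -(ClinMn (sch_linl Hbr P)) gamS (ClinR (sch_linl Hbr P)) /del.
congr (_ *: _); case: k => [|k].
  by rewrite /= (Clin0 phi_lin) subr0 (cp_dbar Hcp).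
rewrite sub0r (ClinN (sch_linl Hbr P)) /dconj -(cp_br Hcp).
by rewrite opprD addrCA subrr addr0.
Qed.

(** The conjugation formula in the form dbar exp (t phi) = exp (t phi) (dbar + [G, -]), which needs
    no inverse exponential. The induction is over all P because its step replaces P by phi P. *)
Lemma dbar_dpow t k P :
  dbar (dpow t k P) = \sum_(i < k.+1) dpow t i (dconj t (k - i) P).
Proof.
elim: k P => [|k IH] P; first by rewrite big_ord1 !dpow0.
apply: (@mulrn_inj _ _ _ _ k).
rewrite (antidiagonal_recur (X := fun i j => dpow t i (dconj t j P))
  (Y := fun i j => Rc t *: dpow t i (phi (dconj t j P)))
  (Z := fun i j => Rc t *: dpow t i (dconj t j (phi P) - phi (dconj t j P)))) => [|i j|i j].
- rewrite -(ClinMn (dbar_lin Hdbar)) dpowSr (ClinR (dbar_lin Hdbar)) IH scaler_sumr.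
  by apply: eq_bigr => i _; rewrite -scalerDr -dpowD addrCA subrr addr0.
- exact: dpowSr.
- by rewrite -dpowZ -dconjS -!scaler_nat dpowZ.
Qed.

Lemma Phi_dbar t P : Phi t (dbar_def br dbar (Gam t) P) = dbar (Phi t P).
Proof.
have E : dbar_def br dbar (Gam t) P = \sum_(j < m) dconj t j P.
  rewrite /dbar_def /Gam (Clin_sum (sch_linl Hbr P)) !big_ord_recl /=.
  by rewrite (Clin0 (sch_linl Hbr P)) add0r.
rewrite E /Phi (Clin_sum (dbar_lin Hdbar)).
under [RHS]eq_bigr => k _ do rewrite dbar_dpow.
rewrite (cauchy_product (X := fun i j => dpow t i (dconj t j P))) => [|i j].
  by apply: eq_bigr => i _; rewrite dpow_sum.
case/orP => h; first by rewrite dpow_eq0 // ltnW.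
case: j h => // j h; rewrite /dconj (gam_eq0 _ h) (Clin0 (sch_linl Hbr P)).
exact: dpow00.
Qed.

Lemma homog_Gam t : homog 2 (Gam t).
Proof. by apply: homog_sum => k; exact: homog_gam. Qed.

Lemma homog_Phi t k P : homog k P -> homog k (Phi t P).
Proof.
by move=> HP; apply: homog_sum => j; apply: homogZ; exact: (iter_homog Hcp).
Qed.

Lemma Gam0 : Gam 0 = 0.
Proof.
rewrite /Gam big1 // => -[[|k] ?] _ //=.
by rewrite exprS mul0r mulr0 Rconst0 scale0r.
Qed.

Lemma Phi_dga_hom t :
  is_dga_hom br (dbar_def br dbar (Gam t)) (dbar_def br dbar (Gam 0)) (Phi t).
Proof.
split.
- by move=> c P Q; exact: Phi_lin.
- by move=> k P; exact: homog_Phi.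
- apply: Phi_bilinear => [Q c P P'|P c Q Q'|P Q]; first exact: wedge_lin_l.
    exact: wedge_lin_r.
  by rewrite (cp_wedge Hcp).
- by apply: Phi_bilinear; [exact: (sch_linl Hbr)|exact: (sch_linr Hbr)|exact: (cp_br Hcp)].
- by move=> P; rewrite Phi_dbar /dbar_def Gam0 (Clin0 (sch_linl Hbr _)) addr0.
Qed.

Lemma wcvg_eventually (P_ : nat -> W) (P : W) :
  (forall k, (m <= k)%N -> P_ k = P) -> wcvg P_ P.
Proof.
by move=> H s x; split; apply: cvg_near_cst; exists m => // k mk; rewrite H.
Qed.

Lemma sum_eventually (F : nat -> W) k : (forall j, (m <= j)%N -> F j = 0) ->
  (m <= k)%N -> \sum_(0 <= j < k) F j = \sum_(j < m) F j.
Proof.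
move=> F0 mk; rewrite (big_cat_nat _ mk) //=.
rewrite [X in _ + X]big_nat [X in _ + X]big1 ?addr0 ?big_mkord //.
by move=> j /andP[mj _]; exact: F0.
Qed.

Lemma Phi_cvg t P :
  wcvg (fun k => \sum_(0 <= j < k) Rc ((j`!%:R)^-1 * t ^+ j) *: iter j phi P) (Phi t P).
Proof.
apply: wcvg_eventually => k; apply: (sum_eventually (F := fun j => dpow t j P)) => j mj.
by apply: dpow_eq0; apply: leq_trans mj; rewrite leqW // leq_addr.
Qed.

Lemma Gam_cvg t :
  wcvg (fun k => \sum_(1 <= j < k)
    Rc ((-1) ^+ j.-1 * (j`!%:R)^-1 * t ^+ j) *: iter j.-1 phi G1) (Gam t).
Proof.
apply: wcvg_eventually => k mk.
rewrite -[RHS](sum_eventually (F := gam t) _ mk); last first.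
  by move=> j mj; apply: gam_eq0; apply: leq_trans mj; rewrite leq_addr.
rewrite [RHS]big_ltn ?(leq_trans _ mk) // add0r.
by apply: eq_big_nat => -[].
Qed.

End Exponential.

Theorem theorem2 (R : realType) (n : nat) (M : manifold R n) (J : gcs M)
    (br : wedgeL J -> wedgeL J -> wedgeL J) (dbar : wedgeL J -> wedgeL J)
    (Hbr : is_schouten br) (Hdbar : is_dbar dbar)
    (G1 : wedgeL J) (phi0 : {linear Lsec J -> Lsec J})
    (phi : wedgeL J -> wedgeL J)
    (Hcp : compatible_pair br dbar G1 phi0 phi) :
  exists (G : R -> wedgeL J) (Phi : R -> wedgeL J -> wedgeL J),
    [/\ forall t : R, wcvg
          (fun N => \sum_(1 <= k < N)
             Rconst M ((-1) ^+ k.-1 * (k`!%:R)^-1 * t ^+ k) *: iter k.-1 phi G1)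
          (G t),
        forall (t : R) (P : wedgeL J), wcvg
          (fun N => \sum_(0 <= k < N)
             Rconst M ((k`!%:R)^-1 * t ^+ k) *: iter k phi P)
          (Phi t P),
        forall t : R, homog 2 (G t) /\
          dbar (G t) + Rconst M 2^-1 *: br (G t) (G t) = 0
      & forall t : R,
          is_dga_hom br (dbar_def br dbar (G t)) (dbar_def br dbar (G 0)) (Phi t)
          /\ forall P : wedgeL J,
               Phi t (dbar_def br dbar (G t) P) = dbar (Phi t P)].
Proof.
have [N nilp] := phi_nilpotent Hbr Hdbar Hcp.
exists (Gam G1 phi N), (Phi phi N); split=> [t|t P|t|t].
- exact: Gam_cvg nilp t.
- exact: Phi_cvg nilp t P.
- by split; [exact: (homog_Gam Hcp)|exact: (maurer_cartan Hbr Hdbar Hcp nilp)].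
- split; first exact: (Phi_dga_hom Hbr Hdbar Hcp nilp).
  by move=> P; exact: (Phi_dbar Hbr Hdbar Hcp nilp).
Qed.
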